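(* Let $X$ be a countable, locally compact, non-compact Hausdorff space and let $\gamma X$ be a compactification of $X$ such that $\gamma X \setminus X$ is Fréchet-Urysohn and $\chi(x, \gamma X) < \mathfrak{t}$ for all $x \in \gamma X \setminus X$. Then $\gamma X$ is Fréchet-Urysohn.
   Context: A space $Z$ is Fréchet-Urysohn if for every $z \in Z$ and $A \subseteq Z$ with $z \in \overline{A}$ there is an $\omega$-indexed sequence in $A$ converging to $z$. A compactification of $X$ is a compact Hausdorff space containing $X$ as a dense subspace. $\chi(z,Z)$ is the character, the least cardinality of a neighbourhood base at $z$ in $Z$. For $A,B \subseteq \omega$, $A \subseteq^* B$ means $A \setminus B$ is finite. A pseudointersection of a family $\mathcal{F}$ of subsets of $\omega$ is a set $P \subseteq \omega$ with $P \subseteq^* F$ for all $F \in \mathcal{F}$. A tower is a transfinite sequence $(T_\alpha)_{\alpha<\lambda}$ of infinite subsets of $\omega$ with $T_\beta \subseteq^* T_\alpha \not\subseteq^* T_\beta$ for all $\alpha<\beta<\lambda$. The tower number $\mathfrak{t}$ is the smallest cardinality of a tower with no infinite pseudointersection. *)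

(* Defs.v *)
From mathcomp Require Import all_boot.
From mathcomp Require Import all_classical.
From mathcomp Require Import wochoice topology.

Set Implicit Arguments.
Unset Strict Implicit.
Unset Printing Implicit Defensive.

Local Open Scope classical_set_scope.
Local Open Scope card_scope.

Definition card_lt {T U : Type} (A : set T) (B : set U) : Prop :=
  (A #<= B) /\ ~ (B #<= A).

Notation "A '#<' B" := (card_lt A B) (at level 79) : card_scope.

(* Cardinal numbers are not available as objects, so a cardinal invariant
   (the least cardinality of a member of F) is represented by a member of F of
   least cardinality; it exists as soon as F is nonempty (least_cardP). *)
Definition least_card {T : Type} (F : set (set T)) : set T :=
  xget set0 [set A | F A /\ forall B, F B -> A #<= B].

Definition frechet_urysohn (Z : topologicalType) : Prop :=
  forall (z : Z) (A : set Z), closure A z ->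
    exists u : nat -> Z, (forall n, A (u n)) /\ u @ \oo --> z.

Definition embedding {X Y : topologicalType} (e : X -> Y) : Prop :=
  injective e /\
  forall A : set X, open A <-> exists2 B : set Y, open B & e @^-1` B = A.

Definition compactification {X Y : topologicalType} (e : X -> Y) : Prop :=
  [/\ compact [set: Y], hausdorff_space Y, embedding e & dense (range e)].

Definition nbhs_base {Z : topologicalType} (z : Z) (B : set (set Z)) : Prop :=
  B `<=` nbhs z /\ forall U, nbhs z U -> exists2 V, B V & V `<=` U.

Definition character {Z : topologicalType} (z : Z) : set (set Z) :=
  least_card [set B | nbhs_base z B].

Definition almost_subset (A B : set nat) : Prop := finite_set (A `\` B).

Notation "A '`<=*`' B" := (almost_subset A B) (at level 70, no associativity)
  : classical_set_scope.

Definition pseudointersection (F : set (set nat)) (P : set nat) : Prop :=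
  forall A, F A -> P `<=*` A.

(* The index ordinal is given by a type I with a (reflexive) well-order R. *)
Definition tower {I : Type} (R : rel I) (T : I -> set nat) : Prop :=
  [/\ well_order R,
      forall a, infinite_set (T a) &
      forall a b, R a b -> a <> b -> T b `<=*` T a /\ ~ T a `<=*` T b].

(* The terms of a tower are pairwise distinct, so the cardinality of the tower
   is that of its set of terms. *)
Definition tower_number : set (set nat) :=
  least_card [set F | exists (I : Type) (R : rel I) (T : I -> set nat),
    [/\ tower R T, F = range T &
        ~ exists2 P, infinite_set P & pseudointersection F P]].

Lemma card_le_inj T U (A : set T) (B : set U) (f : T -> U) :
  (forall x, A x -> B (f x)) -> {in A &, injective f} -> A #<= B.
Proof.
move=> fAB finj; apply: (@card_le_trans _ _ _ (f @` A)).
  by have := inj_card_eq finj; rewrite card_eq_le => /andP[].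
by apply: subset_card_le => _ [x Ax <-]; exact: fAB.
Qed.

Lemma exists_least_card T (F : set (set T)) :
  F !=set0 -> exists A, F A /\ forall B, F B -> A #<= B.
Proof.
move=> [A0 FA0].
have [[A [FA Ae]]|Fne] := pselect (exists A, F A /\ A = set0).
  by exists A; split => // B _; rewrite Ae; exact: card_ge0.
have {}Fne A : F A -> A !=set0.
  by move=> FA; apply/set0P/eqP => A0e; apply: Fne; exists A.
have [t0 _] := Fne _ FA0.
pose P := [set S : set (set T -> T) |
  (forall p A, S p -> F A -> A (p A)) /\
  (forall p q A, S p -> S q -> F A -> p A = q A -> p = q)].
have [|S [[Sin Sinj] Smax]] := @Zorn_bigcup _ P.
  move=> G GP Gtot; split.
    by move=> p A [S GS Sp] FA; have [Sin _] := GP _ GS; exact: (Sin p A).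
  move=> p q A [S GS Sp] [S' GS' Sq] FA pq.
  have [sS|sS] := Gtot _ _ GS GS'.
    by have [_ inj'] := GP _ GS'; apply: (inj' p q A) => //; exact: sS.
  by have [_ inj'] := GP _ GS; apply: (inj' p q A) => //; exact: sS.
have [[A [FA Asurj]]|nsurj] :=
    pselect (exists A, F A /\ forall a, A a -> exists2 p, S p & p A = a).
  exists A; split => // B FB.
  apply: (@card_le_trans _ _ _ S).
    apply: (@card_le_trans _ _ _ ((fun p => p A) @` S)).
      by apply: subset_card_le => a /Asurj[p Sp pa]; exists p.
    exact: card_image_le.
  apply: (@card_le_inj _ _ _ _ (fun p => p B)) => [p Sp|p q]; first exact: (Sin p B).
  by rewrite !inE => Sp Sq; exact: Sinj.
have /choice[r rP] : forall A, exists a, F A -> A a /\ ~ exists2 p, S p & p A = a.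
  move=> A; have [FA|nFA] := pselect (F A); last by exists t0.
  apply: contrapT => H; apply: nsurj; exists A; split => // a Aa.
  by apply: contrapT => Ha; apply: H; exists a.
exfalso; apply: (Smax (S `|` [set r])).
  split; first by move=> p Sp; left.
  move=> /(_ r (or_intror erefl)) Sr.
  by have [_] := rP _ FA0; apply; exists r.
split => [p A [Sp|->] FA|p q A [Sp|->] [Sq|->] FA pq //].
- exact: (Sin p A).
- by have [] := rP _ FA.
- exact: (Sinj p q A).
- by have [_ []] := rP _ FA; exists p.
- by have [_ []] := rP _ FA; exists q.
Qed.

Lemma least_cardP T (F : set (set T)) : F !=set0 ->
  F (least_card F) /\ forall B, F B -> least_card F #<= B.
Proof.
move=> /exists_least_card[A PA].
exact: (@xgetPex _ set0 [set A | F A /\ forall B, F B -> A #<= B]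
  (ex_intro _ A PA)).
Qed.

Lemma characterP (Z : topologicalType) (z : Z) :
  nbhs_base z (character z) /\
  forall B, nbhs_base z B -> character z #<= B.
Proof.
apply: (@least_cardP _ [set B | nbhs_base z B]).
by exists [set U | nbhs z U]; split => // U zU; exists U.
Qed.

Lemma almost_subset_trans B A C : A `<=*` B -> B `<=*` C -> A `<=*` C.
Proof.
move=> AB BC; apply: (@sub_finite_set _ _ ((A `\` B) `|` (B `\` C))).
  by move=> x [Ax nCx]; have [Bx|nBx] := pselect (B x); [right|left].
by rewrite finite_setU.
Qed.

Lemma almost_subset_refl A : A `<=*` A.
Proof. by rewrite /almost_subset setDv; exact: finite_set0. Qed.

Lemma infinite_split (P : set nat) : infinite_set P ->
  exists Q, [/\ Q `<=` P, infinite_set Q & infinite_set (P `\` Q)].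
Proof.
move=> /infiniteP/pcard_leP[f].
have finj : injective f by move=> x y; apply: (@inj _ _ _ f); rewrite inE.
have fP n : P (f n) by apply: (@funS _ _ _ _ f).
have inf (g : nat -> nat) (D : set nat) : injective g ->
    (forall n, D (f (g n))) -> infinite_set D.
  move=> ginj gD; apply/infiniteP.
  apply: (@card_le_inj _ _ _ _ (f \o g)) => [n _|]; first exact: gD.
  by move=> x y _ _ /finj/ginj.
exists (range (fun n => f n.*2)); split.
- by move=> _ [n _ <-].
- by apply: (inf double) => [|n]; [exact: double_inj|exists n].
- apply: (inf (fun n => n.*2.+1)) => [x y [/double_inj]//|n].
  split => // -[m _ /finj] /(congr1 odd).
  by rewrite /= !odd_double.
Qed.

Lemma tower_numberP :
  (exists (I : Type) (R : rel I) (T : I -> set nat),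
    [/\ tower R T, tower_number = range T &
        ~ exists2 P, infinite_set P & pseudointersection tower_number P]) /\
  forall (I : Type) (R : rel I) (T : I -> set nat), tower R T ->
    ~ (exists2 P, infinite_set P & pseudointersection (range T) P) ->
    tower_number #<= range T.
Proof.
pose TF := [set F | exists (I : Type) (R : rel I) (T : I -> set nat),
    [/\ tower R T, F = range T &
        ~ exists2 P, infinite_set P & pseudointersection F P]].
suff : TF !=set0.
  move=> /least_cardP[H1 H2]; split => // I R T tT nT.
  by apply: H2; exists I, R, T.
pose ss (A B : set nat) := A `<=*` B /\ ~ B `<=*` A.
pose P := [set C : set (set nat) | (forall A, C A -> infinite_set A) /\
  forall A B, C A -> C B -> A = B \/ ss A B \/ ss B A].
have [|C [[Cinf Ctot] Cmax]] := @Zorn_bigcup _ P.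
  move=> G GP Gtot; split.
    by move=> A [D GD DA]; have [Dinf _] := GP _ GD; exact: Dinf.
  move=> A B [D GD DA] [E GE EB].
  have [sDE|sED] := Gtot _ _ GD GE.
    by have [_ ] := GP _ GE; apply => //; exact: sDE.
  by have [_ ] := GP _ GD; apply => //; exact: sED.
have Cnop : ~ exists2 Q, infinite_set Q & pseudointersection C Q.
  move=> [Q Qinf QC].
  have [Q' [sQ' Q'inf QQ']] := infinite_split Qinf.
  have Q'C A : C A -> ss Q' A.
    move=> CA; split.
      by apply: (@almost_subset_trans Q) (QC _ CA);
        rewrite /almost_subset (_ : _ `\` _ = set0) ?setD_eq0//; exact: finite_set0.
    by move=> AQ'; apply: QQ'; exact: (@almost_subset_trans A) (QC _ CA) AQ'.
  apply: (Cmax (C `|` [set Q'])).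
    split; first by move=> A CA; left.
    move=> /(_ Q' (or_intror erefl)) /Q'C[_]; apply.
    exact: almost_subset_refl.
  split => [A [/Cinf//|->//]|A B [CA|->] [CB|->]].
  - exact: Ctot.
  - by right; right; exact: Q'C.
  - by right; left; exact: Q'C.
  - by left.
have [W Wwo] := well_ordering_principle (set nat).
pose D := [set A | C A /\ forall B, C B -> B <> A -> W B A -> ss A B].
have Wtot A B : W A B \/ W B A.
  have /orP : W A B || W B A by exact: (@wo_chainW _ W predT (withinW Wwo)).
  by [].
have Dcof A : C A -> exists2 B, D B & B `<=*` A.
  move=> CA.
  have [|B [[/asboolP[CB BA] Bmin] _]] := Wwo (fun B => `[< C B /\ B `<=*` A >]).
    by exists A; apply/asboolP; split => //; exact: almost_subset_refl.
  exists B => //; split => // E CE EB WEB.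
  have nEA : ~ E `<=*` A.
    move=> EA; have WBE : W B E by apply: Bmin; apply/asboolP.
    have [|M [_ Muniq]] := Wwo (pred2 B E); first by exists B; rewrite !inE eqxx.
    have WBB : W B B by have [] := Wtot B B.
    have WEE : W E E by have [] := Wtot E E.
    apply: EB; rewrite -(Muniq E) ?(Muniq B)//; split; rewrite ?inE ?eqxx ?orbT//;
      by move=> ?; rewrite !inE => /orP[]/eqP->.
  have [//|[[//]|[EB' _]]] := Ctot _ _ CB CE.
    by move=> BE; case: EB.
  by case: nEA; exact: almost_subset_trans EB' BA.
exists D; exists {A | D A}, (fun a b => W (sval a) (sval b)), sval; split.
- split.
  + move=> S [x Sx].
    have [|m [[mS mmin] muniq]] := Wwo (fun A => `[< exists a, sval a = A /\ a \in S >]).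
      by exists (sval x); apply/asboolP; exists x.
    have /asboolP[a [am aS]] := mS; exists a; split.
      by split=> // b bS; rewrite am; apply: mmin; apply/asboolP; exists b.
    move=> b [bS bmin]; apply/eq_sig_hprop; first by move=> ? ? ?; exact: Prop_irrelevance.
    rewrite am; apply: muniq; split; first by apply/asboolP; exists b.
    by move=> A /asboolP[c [<- cS]]; exact: bmin.
  + by move=> [A [CA DA]]; exact: Cinf.
  + move=> [A DA] [B DB] /= WAB AB.
    apply: (proj2 DB) => //; first exact: proj1 DA.
    by move=> E; apply: AB; exact: eq_exist.
- by apply/seteqP; split => [A DA|_ [[A DA] _ <-]]//; exists (exist _ A DA).
- move=> [Q Qinf QD]; apply: Cnop; exists Q => // A /Dcof[B DB].
  by apply: almost_subset_trans; exact: QD.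
Qed.

(* Main.v *)
Require Import Defs.
From mathcomp Require Import all_boot all_classical topology.
From mathcomp Require Import wochoice.

(* The points of [range e] have countable neighbourhoods, and limits of sets of
   points of the remainder are covered by hypothesis.  What is left is a point
   z of the remainder in the closure of a countable set C: a sequence of C
   converging to z is an infinite pseudointersection of the traces on C of
   fewer than t neighbourhoods of z.  Its existence is p = t, the theorem of
   Malliaris and Shelah.

   Let I be an initial well-order indexing a family B of least cardinality
   p < t, closed under finite meets and without pseudointersection, so that
   smaller families with infinite finite meets have pseudointersections
   (saturation).  A construction of a decreasing I-sequence below B must break
   down (else t gives a pseudointersection of B), and the failure is coded by a
   cut (d_j)_(j in D), (e_i)_(i in I) of functions nat -> nat, modulo finite,
   with D smaller than I, which remains unfilled on every infinite subset of
   its domain.  For the initial segment S of I of size #|D|^+ choose injections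
   g_c : {b < c} -> D and codes y_c with F(y_b, y_c) = d_(g_c b).  By recursion
   on I, saturation builds sets N_a of codes on which F is bounded by a, such
   that y_c is in N_a for e_i <= a < e_c; since #|I| < t, one N works for all i.
   Each y_c stays in N_a down to some m_c below all e_i, hence, the cut being
   unfilled, m_c < d_j for some j in D.  Two indices b < c with the same j then
   satisfy g_c b < j, so S embeds into D * D, which is absurd.

   The ultrapower of nat by a generic ultrafilter is replaced throughout by
   functions on an infinite set which shrinks along the constructions. *)

Set Implicit Arguments.
Unset Strict Implicit.
Unset Printing Implicit Defensive.

Local Open Scope classical_set_scope.
Local Open Scope card_scope.

(** * Well-orders and cardinals *)

Definition strict_wo {T : Type} (lt : T -> T -> Prop) : Prop :=
  [/\ forall x, ~ lt x x,
      forall x y z, lt x y -> lt y z -> lt x z,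
      forall x y, [\/ lt x y, x = y | lt y x] &
      forall P : set T, P !=set0 -> exists2 x, P x & forall y, P y -> ~ lt y x].

Definition below {T : Type} (lt : T -> T -> Prop) (i : T) : set T :=
  [set x | lt x i].

Lemma well_order_strict (T : Type) (R : rel T) : well_order R ->
  strict_wo (fun x y => R x y /\ x <> y).
Proof.
move=> Rwo.
have Rmin (P : set T) : P !=set0 ->
    exists2 x, P x & forall y, P y -> R x y.
  move=> [x Px]; have [|z [[zP zmin] _]] := Rwo (fun y => `[< P y >]).
    by exists x; apply/asboolP.
  by exists z; [apply/asboolP|move=> y Py; apply: zmin; apply/asboolP].
have Rxx x : R x x.
  by have [|y -> /(_ _ erefl)] := Rmin [set x]; first by exists x.
have Ranti x y : R x y -> R y x -> x = y.
  move=> xy yx; have [|z [_ zmin]] := Rwo (fun z => `[< z = x \/ z = y >]).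
    by exists x; apply/asboolP; left.
  have minA t : t = x \/ t = y ->
      minimum_of R (fun z => `[< z = x \/ z = y >]) t.
    move=> txy; split; first exact/asboolP.
    by move=> u /asboolP[]->; case: txy => ->.
  by rewrite -(zmin x) ?(zmin y)//; apply: minA; [right|left].
have Rtot x y : R x y \/ R y x.
  have [|z [->|->] zmin] := Rmin [set z | z = x \/ z = y]; first by exists x; left.
    by left; apply: zmin; right.
  by right; apply: zmin; left.
have Rtr x y z : R x y -> R y z -> R x z.
  move=> xy yz.
  have [|t [->|[->|->]] tmin] := Rmin [set t | t = x \/ t = y \/ t = z].
  - by exists x; left.
  - by apply: tmin; right; right.
  - by rewrite (Ranti x y)//; apply: tmin; left.
  - by rewrite -(Ranti y z)//; apply: tmin; right; left.
split.
- by move=> x [].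
- move=> x y z [xy nxy] [yz nyz]; split; first exact: Rtr yz.
  by move=> xz; apply: nxy; apply: Ranti => //; rewrite xz.
- move=> x y; have [->|nxy] := pselect (x = y); first by constructor 2.
  by have [xy|yx] := Rtot x y; [constructor 1|constructor 3; split => // /esym].
- move=> P /Rmin[x Px xmin]; exists x => // y Py [yx]; apply.
  by apply: Ranti => //; exact: xmin.
Qed.

Lemma strict_wo_exists (T : Type) : exists lt : T -> T -> Prop, strict_wo lt.
Proof.
have [W Wwo] := well_ordering_principle {classic T}.
by exists (fun x y : T => W x y /\ x <> y); exact: well_order_strict.
Qed.

Lemma wf_min (T : Type) (lt : T -> T -> Prop) :
  (forall P : set T, P !=set0 -> exists2 x, P x & forall y, P y -> ~ lt y x) ->
  well_founded lt.
Proof.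
move=> ltmin x; apply: contrapT => nx.
have [|y ny ymin] := ltmin [set y | ~ Acc lt y]; first by exists x.
by apply: ny; constructor => z zy; apply: contrapT => nz; exact: ymin zy.
Qed.

Lemma strict_wo_wf (T : Type) (lt : T -> T -> Prop) :
  strict_wo lt -> well_founded lt.
Proof. by case=> _ _ _; exact: wf_min. Qed.

(** Transfinite recursion with a relation: [S i h q] means that [q] is admissible at stage [i] given
    [h] before [i]. The value is chosen for the part already built, extended by the default [q0],
    and the invariance of [S] carries the choice over to [h]. *)
Lemma wf_recursion (T Q : Type) (q0 : Q) (lt : T -> T -> Prop)
    (S : T -> (T -> Q) -> Q -> Prop) :
  well_founded lt ->
  (forall i j k, lt i j -> lt j k -> lt i k) ->
  (forall i h h' q, (forall j, lt j i -> h j = h' j) -> S i h q -> S i h' q) ->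
  (forall i h, (forall j, lt j i -> S j h (h j)) -> exists q, S i h q) ->
  exists h, forall i, S i h (h i).
Proof.
move=> wf tr Sext Sex.
pose ext i (r : forall j, lt j i -> Q) j :=
  if pselect (lt j i) is left p then r j p else q0.
pose F i (r : forall j, lt j i -> Q) :=
  if pselect (exists q, S i (ext i r) q) is left p then sval (cid p) else q0.
pose h := Fix wf (fun _ => Q) F.
have hE i : h i = F i (fun j _ => h j).
  apply: Fix_eq => {}i f g fg; congr F.
  by apply: functional_extensionality_dep => j;
     apply: functional_extensionality_dep.
exists h => i; elim/(well_founded_ind wf): i => i IH.
have extE j : lt j i -> h j = ext i (fun j _ => h j) j.
  by rewrite /ext; case: pselect.
have : exists q, S i (ext i (fun j _ => h j)) q.
  apply: Sex => j ji; rewrite -extE//.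
  by apply: (Sext j h) (IH _ ji) => k kj; apply: extE; exact: tr ji.
rewrite hE /F => e; case: pselect => // e'.
by apply: Sext (svalP (cid e')) => j /extE.
Qed.

Lemma card_le_fun (T U : Type) (A : set T) (B : set U) (u0 : U) : A #<= B ->
  exists2 f : T -> U, forall x, A x -> B (f x) &
    forall x y, A x -> A y -> f x = f y -> x = y.
Proof.
move=> /card_leP[f].
exists (fun x => if pselect (A x) is left p then
  set_val (f (exist (fun x => x \in A) x (mem_set p))) else u0).
  by move=> x Ax; case: pselect => // p; exact: set_valP.
move=> x y Ax Ay; case: pselect => // p; case: pselect => // q.
move=> /val_inj/(@inj _ _ _ f) e.
by have /(congr1 sval) := e (mem_set I) (mem_set I).
Qed.

Lemma card_le_set_inj (T U : Type) (A : set T) (B : set U) (f : T -> U) :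
  (forall x, A x -> B (f x)) ->
  (forall x y, A x -> A y -> f x = f y -> x = y) -> A #<= B.
Proof.
move=> fAB finj; apply: (card_le_inj fAB) => x y; rewrite !inE; exact: finj.
Qed.

Lemma card_le_setX (T U : Type) (A : set T) (B : set U) :
  A #<= B -> A `*` A #<= B `*` B.
Proof.
move=> AB; have [->|/set0P[a Aa]] := eqVneq A set0.
  by rewrite set0X; exact: card_ge0.
have [u0] : exists u : U, True.
  have [B0|/set0P[u _]] := eqVneq B set0; last by exists u.
  by move: AB; rewrite B0 => /card_le0P A0; rewrite A0 in Aa.
move=> _; have [f fAB finj] := card_le_fun u0 AB.
apply: (@card_le_set_inj _ _ _ _ (fun p => (f p.1, f p.2))).
  by move=> [x y] [/= Ax Ay]; split; exact: fAB.
move=> [x y] [x' y'] [/= Ax Ay] [/= Ax' Ay'] [e1 e2].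
by congr pair; exact: finj.
Qed.

(** The two parts of the union go to two distinct lines, with second coordinates [a] and [b], of the
    square of [A]. *)
Lemma card_setU_square (T : Type) (A B : set T) :
  infinite_set A -> A `*` A #<= A -> B #<= A -> A `|` B #<= A.
Proof.
move=> Ainf AA BA; apply: card_le_trans AA.
have [a Aa] := infinite_setN0 Ainf.
have [b [Ab ba]] : exists b, A b /\ b <> a.
  apply: contrapT => nb; apply: Ainf; apply: (@sub_finite_set _ _ [set a]).
    by move=> b Ab; apply: contrapT => ba; apply: nb; exists b.
  exact: finite_set1.
have [f fBA finj] := card_le_fun a BA.
apply: (@card_le_set_inj _ _ _ _
    (fun x => if pselect (A x) then (x, a) else (f x, b))).
  move=> x; case: pselect => [|nAx [//|Bx]]; first by split.
  by split => //=; exact: fBA.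
move=> x y; case: pselect => Ax; case: pselect => Ay; move=> hx hy [].
- by [].
- by move=> _ /esym.
- by [].
- by apply: finj; [case: hx|case: hy].
Qed.

(** * Squares of infinite sets *)

Section square.
Variables (T : Type) (lt : T -> T -> Prop).
Hypothesis lt_wo : strict_wo lt.

Let mx (p : T * T) := if pselect (lt p.1 p.2) then p.2 else p.1.

(** Hessenberg's argument. Pairs are ordered by their maximum, ties being broken by an arbitrary
    well-order. A pair then has fewer predecessors than [D] has elements, so an injection into [D]
    can be built greedily. *)
Lemma square_initial (D : set T) : infinite_set D ->
  (forall i, D i -> infinite_set (D `&` below lt i) ->
     (D `&` below lt i) `*` (D `&` below lt i) #<= (D `&` below lt i)) ->
  (forall i, D i -> ~ (D #<= D `&` below lt i)) ->
  D `*` D #<= D.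
Proof.
have [lti ltt lttot ltmin] := lt_wo.
move=> Dinf IH Dini.
have [d Dd] := infinite_setN0 Dinf.
have [lt' [_ lt't lt'tot lt'min]] := strict_wo_exists (T * T)%type.
pose lt2 p q := lt (mx p) (mx q) \/ mx p = mx q /\ lt' p q.
have lt2t p q r : lt2 p q -> lt2 q r -> lt2 p r.
  move=> [pq|[pq pq']] [qr|[qr qr']].
  - by left; exact: ltt qr.
  - by left; rewrite -qr.
  - by left; rewrite pq.
  - by right; split; [rewrite pq|exact: lt't qr'].
have lt2min (P : set (T * T)) : P !=set0 ->
    exists2 x, P x & forall y, P y -> ~ lt2 y x.
  move=> [p Pp].
  have [|_ [q Pq <-] qmin] := ltmin (mx @` P); first by exists (mx p), p.
  have [|r [Pr rq] rmin] := lt'min [set r | P r /\ mx r = mx q]; first by exists q.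
  exists r => // s Ps [|[e]].
    by rewrite rq; apply: qmin; exists s.
  by apply: rmin; split => //; rewrite e.
pose S p (h : T * T -> T) q := (D `*` D) p ->
  D q /\ forall p', lt2 p' p -> (D `*` D) p' -> h p' <> q.
have [|i h h' q hh' H Dp|p h Sh|h hP] := @wf_recursion _ _ d lt2 S (wf_min lt2min).
- by move=> p q r; exact: lt2t.
- have [Dq H'] := H Dp; split => // p' p'i Dp'; rewrite -hh'//; exact: H'.
- have [Dp|nDp] := pselect ((D `*` D) p); last by exists d => /nDp.
  set m := mx p.
  have Dm : D m by rewrite /m /mx; case: Dp; case: pselect.
  pose M := (D `&` below lt m) `|` [set m].
  apply: contrapT => nex.
  (* If no value were free, [h] would map the predecessors of [p] onto [D], and their coordinates
     lie in [M]. *)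
  have DMM : D #<= M `*` M.
    apply: (card_le_trans _ (card_image_le h (M `*` M))).
    apply: subset_card_le => x Dx; apply: contrapT => nx; apply: nex.
    exists x => _; split => // q qp Dq hq; apply: nx; exists q => //.
    have {qp} qm : lt (mx q) m \/ mx q = m by case: qp => [|[]]; [left|right].
    have le : (lt q.1 (mx q) \/ q.1 = mx q) /\ (lt q.2 (mx q) \/ q.2 = mx q).
      rewrite /mx; case: pselect => /= q12; split; try (by left); try (by right).
      by have [//|->|] := lttot q.1 q.2; [right|left].
    have aux y : D y -> lt y (mx q) \/ y = mx q -> M y.
      move=> Dy yq; have : lt y m \/ y = m.
        case: yq => [yq|->//]; left; case: qm => [qm|<-//]; exact: ltt qm.
      by case=> ym; [left|right].
    case: Dq le => Dq1 Dq2 [l1 l2]; split; exact: aux.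
  have [Lfin|Linf] := pselect (finite_set (D `&` below lt m)).
    apply: Dinf; apply: (card_le_finite DMM).
    by apply: finite_setX; rewrite /M finite_setU.
  apply: (Dini m Dm); apply: (card_le_trans DMM).
  apply: (@card_le_trans _ _ _ ((D `&` below lt m) `*` (D `&` below lt m))).
  2: exact: IH.
  apply: card_le_setX; apply: card_setU_square => //; first exact: IH.
  have [l Ll] := infinite_setN0 Linf.
  by apply: (@card_le_set_inj _ _ _ _ (fun _ => l)) => // x y -> ->.
- apply: (@card_le_set_inj _ _ _ _ h) => [p Dp|p q Dp Dq hpq].
    by have [] := hP p Dp.
  apply: contrapT => npq.
  have : lt2 p q \/ lt2 q p.
    have [] := lttot (mx p) (mx q); [by left; left| |by right; left].
    move=> e; have [pq|//|qp] := lt'tot p q; [left|right]; by right.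
  case=> [pq|qp].
    by have [_ /(_ _ pq Dp)] := hP q Dq; apply.
  by have [_ /(_ _ qp Dq)] := hP p Dp; apply.
Qed.

Lemma card_square_aux (A : set T) : infinite_set A -> A `*` A #<= A.
Proof.
have [lti ltt lttot ltmin] := lt_wo.
(* Either [D] embeds into one of its proper segments, whose square is known, or it has initial type
   and [square_initial] applies. *)
have seg (D : set T) : infinite_set D ->
    (forall i, D i -> infinite_set (D `&` below lt i) ->
     (D `&` below lt i) `*` (D `&` below lt i) #<= (D `&` below lt i)) -> D `*` D #<= D.
  move=> Dinf IH.
  have [[i [Di Dle]]|nex] := pselect (exists i, D i /\ D #<= (D `&` below lt i)).
    apply: (card_le_trans (card_le_setX Dle)).
    apply: (@card_le_trans _ _ _ (D `&` below lt i)).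
      by apply: IH => // Lfin; apply: Dinf; exact: card_le_finite Lfin.
    by apply: subset_card_le => x [].
  by apply: square_initial => // i Di Dle; apply: nex; exists i.
have segE i k : lt k i -> (A `&` below lt i) `&` below lt k = A `&` below lt k.
  move=> ki; apply/seteqP; split=> x [] => [[]//|Ax xk].
  by split=> //; split=> //; exact: ltt ki.
have Aseg i : infinite_set (A `&` below lt i) ->
    (A `&` below lt i) `*` (A `&` below lt i) #<= (A `&` below lt i).
  elim/(well_founded_ind (strict_wo_wf lt_wo)): i => i IH Linf.
  by apply: seg => // k [_ /= ki]; rewrite segE//; exact: IH.
by move=> Ainf; apply: seg => // i _; exact: Aseg.
Qed.
End square.

Lemma card_square (T : Type) (A : set T) : infinite_set A -> A `*` A #<= A.
Proof. by have [lt /card_square_aux] := strict_wo_exists T; apply. Qed.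

Lemma card_setU_infinite (T : Type) (A B : set T) :
  infinite_set A -> B #<= A -> A `|` B #<= A.
Proof. by move=> Ainf; apply: card_setU_square => //; exact: card_square. Qed.

Lemma card_seq (T : Type) : infinite_set [set: T] -> [set: seq T] #<= [set: T].
Proof.
move=> Tinf; have [t0 _] := infinite_setN0 Tinf.
have [f _ finj] := card_le_fun t0 (card_square Tinf).
have /(card_le_fun t0)[g _ ginj] : [set: nat] #<= [set: T] by apply/infiniteP.
pose code := foldr (fun x y => f (x, y)) t0.
apply: (@card_le_set_inj _ _ _ _ (fun s => f (g (size s), code s))) => // s s' _ _.
move=> /finj -/(_ (conj I I) (conj I I))[/ginj -/(_ I I)].
by elim: s s' => [|x s IH] [|x' s']//= [ss']
  /finj -/(_ (conj I I) (conj I I))[-> /IH ->].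
Qed.

Lemma card_cover (T U : Type) (A : set T) (B : set U) :
  A !=set0 -> A #<= B ->
  exists f : U -> T, (forall y, A (f y)) /\
    forall x, A x -> exists2 y, B y & f y = x.
Proof.
move=> [a Aa] AB.
have [u0] : exists u : U, True.
  have [B0|/set0P[u _]] := eqVneq B set0; last by exists u.
  by move: AB; rewrite B0 => /card_le0P A0; rewrite A0 in Aa.
move=> _; have [f fAB finj] := card_le_fun u0 AB.
exists (fun y =>
  if pselect (exists2 x, A x & f x = y) is left p then sval (cid2 p) else a).
split=> [y|x Ax]; first by case: pselect => // p; case: (cid2 p).
exists (f x); first exact: fAB.
case: pselect => [p|[]]; last by exists x.
by case: (cid2 p) => /= x' Ax' /finj -> .
Qed.

(** If some segment of a well-order is as large as [T], the order of the shortest such segment is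
    pulled back to [T]. *)
Lemma initial_wo (T : Type) : exists2 lt : T -> T -> Prop, strict_wo lt &
  forall i, ~ ([set: T] #<= below lt i).
Proof.
have [lt lt_wo] := strict_wo_exists T; have [lti ltt lttot ltmin] := lt_wo.
have [[i0 i0P]|nex] := pselect (exists i, [set: T] #<= below lt i); last first.
  by exists lt => // i iT; apply: nex; exists i.
have [|i Ti imin] := ltmin [set i | [set: T] #<= below lt i]; first by exists i0.
have [f fi /(_ _ _ I I) finj] := card_le_fun i Ti.
exists (fun x y => lt (f x) (f y)).
  split.
  - by move=> x; exact: lti.
  - by move=> x y z; exact: ltt.
  - move=> x y; have [] := lttot (f x) (f y); try by constructor.
    by move=> /finj; constructor.
  - move=> P [x Px]; have [|_ [y Py <-] ymin] := ltmin (f @` P).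
      by exists (f x), x.
    by exists y => // z Pz; apply: ymin; exists z.
move=> j jT; apply: (imin (f j)) (fi j I).
by apply: (card_le_trans jT); apply: (@card_le_set_inj _ _ _ _ f) => // x y _ _ /finj.
Qed.

(** * Sets of natural numbers modulo finite *)

Definition unbounded (A : set nat) : Prop := forall N, exists2 n, N <= n & A n.

(** This is almost inclusion again, in a form that lets [P] be read as a property of almost all
    points of [A]. *)
Definition ae (A P : set nat) : Prop := exists N, forall n, N <= n -> A n -> P n.

Lemma finite_bounded (A : set nat) :
  finite_set A <-> exists N, forall n, A n -> n < N.
Proof.
split=> [/finite_seqP[s ->]|[N AN]]; last first.
  by apply: (@sub_finite_set _ _ `I_N) => //; exact: finite_II.
exists (\max_(n <- s) n).+1 => n /= ns.
by rewrite ltnS; exact: (leq_bigmax_seq _ (F := id) ns).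
Qed.

Lemma infinite_unbounded (A : set nat) : infinite_set A <-> unbounded A.
Proof.
split=> [Ainf N|Aunb /finite_bounded[N AN]].
  apply: contrapT => nex; apply: Ainf; apply/finite_bounded; exists N => n An.
  by rewrite ltnNge; apply/negP => Nn; apply: nex; exists n.
by have [n Nn /AN] := Aunb N; rewrite ltnNge Nn.
Qed.

Lemma almost_subset_ae (A B : set nat) : A `<=*` B <-> ae A B.
Proof.
split=> [/finite_bounded[N H]|[N H]].
  exists N => n Nn An; apply: contrapT => nB.
  by have := H n (conj An nB); rewrite ltnNge Nn.
apply/finite_bounded; exists N => n [An nBn].
by rewrite ltnNge; apply/negP => Nn; apply: nBn; exact: H.
Qed.

Lemma ae_refl A : ae A A. Proof. by exists 0. Qed.

Lemma sub_ae (A P : set nat) : A `<=` P -> ae A P.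
Proof. by move=> AP; exists 0 => n _; exact: AP. Qed.

Lemma ae_trans B A C : ae A B -> ae B C -> ae A C.
Proof.
move=> [N AB] [M BC]; exists (maxn N M) => n; rewrite geq_max => /andP[Nn Mn] An.
by apply: BC => //; exact: AB.
Qed.

Lemma aeI A P Q : ae A P -> ae A Q -> ae A (P `&` Q).
Proof.
move=> [N AP] [M AQ]; exists (maxn N M) => n; rewrite geq_max => /andP[Nn Mn] An.
by split; [exact: AP|exact: AQ].
Qed.

Lemma aeS A P Q : P `<=` Q -> ae A P -> ae A Q.
Proof. by move=> PQ [N AP]; exists N => n Nn An; apply: PQ; exact: AP. Qed.

Lemma ae_in A P : ae A P -> ae A (A `&` P).
Proof. by move=> AP; exact: aeI (ae_refl A) AP. Qed.

Lemma ae_all (T : eqType) (s : seq T) (A : set nat) (P : T -> set nat) :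
  (forall i, i \in s -> ae A (P i)) ->
  ae A [set n | forall i, i \in s -> P i n].
Proof.
elim: s => [_|x s IH H]; first by exists 0.
have /IH Hs i : i \in s -> ae A (P i).
  by move=> si; apply: H; rewrite inE si orbT.
have Hx : ae A (P x) by apply: H; rewrite inE eqxx.
apply: aeS (aeI Hx Hs) => n [Pxn Psn] i; rewrite inE => /orP[/eqP->//|].
exact: Psn.
Qed.

Lemma ae_large A N : ae A [set n | N <= n].
Proof. by exists N. Qed.

Lemma unbounded_ae A P : unbounded A -> ae A P -> unbounded (A `&` P).
Proof.
move=> Au [N AP] M; have [n] := Au (maxn N M).
by rewrite geq_max => /andP[Nn Mn] An; exists n => //; split => //; exact: AP.
Qed.

Lemma unboundedS A B : A `<=` B -> unbounded A -> unbounded B.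
Proof. by move=> AB Au N; have [n ? /AB] := Au N; exists n. Qed.

Lemma bounded_image (f : nat -> nat) N : exists K, forall n, n < N -> f n < K.
Proof.
exists (\max_(i < N) f i).+1 => n nN; rewrite ltnS.
exact: (leq_bigmax (Ordinal nN)).
Qed.

Lemma bounded_image2 (f : nat -> nat -> nat) (h : nat -> nat) N :
  exists K, forall n m, n < N -> m <= h n -> f n m < K.
Proof.
have [g gP] : exists g : nat -> nat, forall n m, m <= h n -> f n m < g n.
  have /choice[g gP] n : exists K, forall m, m <= h n -> f n m < K.
    by have [K KP] := bounded_image (f n) (h n).+1; exists K => m; exact: KP.
  by exists g.
have [K KP] := bounded_image g N; exists K => n m nN mh.
exact: leq_trans (gP _ _ mh) (ltnW (KP _ nN)).
Qed.

Lemma injective_unbounded (A : set nat) (f : nat -> nat) : unbounded A ->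
  (forall x y, A x -> A y -> f x = f y -> x = y) -> unbounded (f @` A).
Proof.
move=> /infinite_unbounded Ainf finj; apply/infinite_unbounded => fA; apply: Ainf.
apply: (card_le_finite _ fA); exact: (@card_le_set_inj _ _ _ _ f).
Qed.

Lemma unbounded_range (f : nat -> nat) : injective f -> unbounded (range f).
Proof.
by move=> finj; apply: injective_unbounded => [N|x y _ _ /finj//]; exists N.
Qed.

(** A tower decreases strictly, so only the set [J] of indices where the sequence drops strictly
    below all earlier terms is kept; each term almost includes one indexed by [J]. The set [A0]
    serves as the answer when [D] is empty. *)
Lemma tower_pseudointersection (I : Type) (lt : I -> I -> Prop) (D : set I)
    (A0 : set nat) (A : I -> set nat) :
  strict_wo lt -> ~ (tower_number #<= [set: I]) -> unbounded A0 ->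
  (forall i, D i -> unbounded (A i)) ->
  (forall i, D i -> ae (A i) A0) ->
  (forall i j, D i -> D j -> lt j i -> ae (A i) (A j)) ->
  exists P, [/\ unbounded P, P `<=` A0 & forall i, D i -> ae P (A i)].
Proof.
move=> lt_wo tI A0u Au AA0 Adec; have [lti ltt lttot ltmin] := lt_wo.
have [[d Dd]|D0] := pselect (exists d, D d); last first.
  by exists A0; split=> // i Di; case: D0; exists i.
suff [P [Pu PA]] : exists P, unbounded P /\ forall i, D i -> ae P (A i).
  have PA0 : ae P A0 by exact: ae_trans (PA d Dd) (AA0 d Dd).
  exists (P `&` A0); split; [exact: unbounded_ae|by move=> n []|].
  by move=> i /PA; apply: ae_trans; apply: sub_ae => n [].
pose J := [set i | D i /\ forall j, D j -> lt j i -> ~ ae (A j) (A i)].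
have Jcof i : D i -> exists2 j, J j & ae (A j) (A i).
  move=> Di; have [|j [Dj ji] jmin] := ltmin [set j | D j /\ ae (A j) (A i)].
    by exists i; split => //; exact: ae_refl.
  exists j => //; split => // k Dk kj Akj; apply: (jmin k) => //.
  by split => //; exact: ae_trans ji.
pose R (a b : {i | J i}) := `[< lt (sval a) (sval b) \/ a = b >].
have ltR a b : R a b -> a <> b -> lt (sval a) (sval b) by move=> /asboolP[].
have Twr : tower R (fun a => A (sval a)).
  split.
  - apply: antisymmetric_well_order.
      move=> a b /andP[/asboolP ab /asboolP ba].
      case: ab => // ab; case: ba => // ba.
      by case: (lti (sval a)); exact: ltt ba.
    move=> S [a Sa].
    have [|_ [b Sb <-] bmin] := ltmin [set i | exists2 b, b \in S & sval b = i].
      by exists (sval a), a.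
    exists b; split => // c Sc; apply/asboolP.
    have [|e|/bmin[]] := lttot (sval b) (sval c); [by left| |by exists c].
    by right; apply: eq_sig_hprop e => ? ? ?; exact: Prop_irrelevance.
  - by move=> a; apply/infinite_unbounded; have [Da _] := svalP a; exact: Au.
  - move=> a b ab anb; have {ab} := ltR _ _ ab anb.
    have [Di _] := svalP a; have [Dj Jj] := svalP b => ij; split.
      by apply/almost_subset_ae; exact: Adec.
    by move/almost_subset_ae; exact: Jj.
have [_ tP] := tower_numberP.
have [[P Pinf PA]|nP] := pselect (exists2 P, infinite_set P &
    pseudointersection (range (fun a : {i | J i} => A (sval a))) P).
  exists P; split; first exact/infinite_unbounded.
  move=> i /Jcof[j Jj]; apply: ae_trans; apply/almost_subset_ae; apply: PA.
  by exists (exist _ j Jj).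
exfalso; apply: tI; apply: (card_le_trans (tP _ _ _ Twr nP)).
apply: (card_le_trans (card_image_le _ _)).
apply: (@card_le_set_inj _ _ _ _ sval) => // a b _ _.
by apply: eq_sig_hprop => ? ? ?; exact: Prop_irrelevance.
Qed.

(* Nonempty columns X n become an infinite set of codes, so pseudointersections
   can be used to choose elements of the columns. *)
Definition graph (T : countType) (X : nat -> set T) : set nat :=
  [set p | exists n x, p = pickle (n, x) /\ X n x].

Lemma graphE (T : countType) (X : nat -> set T) n x :
  graph X (pickle (n, x)) <-> X n x.
Proof.
split=> [[m [y [/(pcan_inj pickleK)[-> ->]]]]//|Xnx].
by exists n, x.
Qed.

(** Only finitely many pairs have a code below [M], so their columns are bounded. *)
Lemma pickle_column (T : countType) M :
  exists K, forall n (x : T), K <= n -> M <= pickle (n, x).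
Proof.
have [K KP] := bounded_image
  (fun p => if unpickle p is Some nx then (nx : nat * T).1 else 0) M.
exists K => n x Kn; rewrite leqNgt; apply/negP => /KP.
by rewrite pickleK ltnNge Kn.
Qed.

Lemma unbounded_graph (T : countType) (X : nat -> set T) (A : set nat) :
  unbounded A -> (forall n, A n -> X n !=set0) -> unbounded (graph X).
Proof.
move=> Au AX.
have [x0] : exists x0 : T, True by have [n _ /AX[x _]] := Au 0; exists x.
have /choice[c cP] : forall n, exists x, A n -> X n x.
  move=> n; have [/AX[x Xx]|nA] := pselect (A n); first by exists x.
  by exists x0.
move=> _; apply: (@unboundedS ((fun n => pickle (n, c n)) @` A)).
  by move=> _ [n An <-]; apply/graphE; exact: cP.
by apply: injective_unbounded => // m n _ _ /(pcan_inj pickleK)[].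
Qed.

Lemma nat_least (P : nat -> Prop) : (exists n, P n) ->
  exists n, P n /\ forall m, P m -> n <= m.
Proof.
move=> [n Pn]; have : exists n, `[< P n >] by exists n; apply/asboolP.
move=> /ex_minnP[m /asboolP Pm mmin]; exists m; split => // k Pk.
by apply: mmin; apply/asboolP.
Qed.

Lemma nat_greatest (P : nat -> Prop) K : (exists n, P n) ->
  (forall n, P n -> n <= K) -> exists n, P n /\ forall m, P m -> m <= n.
Proof.
move=> [n Pn] PK; have Pex : exists n, `[< P n >] by exists n; apply/asboolP.
have Pub m : `[< P m >] -> m <= K by move=> /asboolP/PK.
have [m /asboolP Pm mmax] := ex_maxnP Pex Pub; exists m; split => // k Pk.
by apply: mmax; apply/asboolP.
Qed.

Lemma count_lt (T : eqType) (p q : pred T) (s : seq T) (x : T) :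
  (forall y, y \in s -> p y -> q y) -> x \in s -> q x -> ~~ p x ->
  count p s < count q s.
Proof.
elim: s => [//|y s IH] pq; rewrite inE => /orP[/eqP->|xs] qx npx /=.
  rewrite qx (negbTE npx) add0n add1n ltnS -!size_filter.
  rewrite !size_filter; elim: s pq {IH} => //= z s IH pq.
  apply: leq_add; last first.
    by apply: IH => w; rewrite inE => /orP[/eqP->|ws]; apply: pq;
       rewrite !inE ?eqxx ?ws ?orbT.
  by have := pq z; rewrite !inE eqxx orbT => /(_ isT); case: (p z) => // ->.
rewrite -addnS; apply: leq_add.
  by have := pq y (mem_head _ _); case: (p y) => // ->.
by apply: IH => // z zs; apply: pq; rewrite inE zs orbT.
Qed.

Lemma countable_setU (T : Type) (A B : set T) :
  countable A -> countable B -> countable (A `|` B).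
Proof.
move=> Ac Bc.
have : countable (\bigcup_(b in [set: bool]) (if b then A else B)).
  by apply: bigcup_countable => [|[]//]; exact: countableP.
by apply: sub_countable; apply: subset_card_le => x []; [exists true|exists false].
Qed.

(* A number z stores a finite function on nat, so that a colouring of pairs of
   numbers can be prescribed although app_code is fixed. *)
Definition decode (z : nat) : seq nat := odflt [::] (unpickle z).

Definition app_code (x z : nat) : nat := nth 0 (decode z) x.

(** With [app_code] as the function F of the overview, such lists stand for the sets N_a. *)
Definition bounded_clique (a : nat) (l : seq nat) : Prop :=
  forall x y, x \in l -> y \in l -> x < y -> app_code x y <= a.

Lemma code_exists (T : eqType) (s : seq T) (y v : T -> nat) :
  (forall b c, b \in s -> c \in s -> y b = y c -> b = c) ->
  exists z, forall b, b \in s -> y b < z /\ app_code (y b) z = v b.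
Proof.
move=> yinj; pose K := (\max_(b <- s) y b).+1.
have yK b : b \in s -> y b < K by move=> bs; rewrite ltnS leq_bigmax_seq.
pose f x := nth 0 (map v s) (index x (map y s)).
(* All lists of length [K + m] have the prescribed entries, and their codes are unbounded, so one
   code is at least [K], hence above all [y b]. *)
have [|z Kz [m _ zE]] := @unbounded_range (fun m => pickle (mkseq f (K + m))) _ K.
  by move=> m m' /(pcan_inj pickleK)/(congr1 size); rewrite !size_mkseq => /addnI.
exists (pickle (mkseq f (K + m))) => b bs; split.
  by rewrite zE; exact: leq_trans (yK b bs) Kz.
rewrite /app_code /decode pickleK /= nth_mkseq; last first.
  exact: leq_trans (yK b bs) (leq_addr _ _).
have ys : y b \in map y s by exact: map_f.
have is_ : index (y b) (map y s) < size s by rewrite -(size_map y) index_mem.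
rewrite /f (nth_map b)//; congr v; apply: yinj => //; first exact: mem_nth.
by rewrite -(nth_map b 0)// nth_index.
Qed.

(** * Below the tower number *)

Section below_tower_number.
Variables (I : choiceType) (i0 : I) (lt : I -> I -> Prop).
Hypothesis lt_wo : strict_wo lt.
Hypothesis I_tower : ~ (tower_number #<= [set: I]).

(** Fewer than t dense open families have a common member. Stage [i] shrinks a pseudointersection of
    the earlier stages into [E i]; openness keeps the final pseudointersection in every [E i]. *)
Lemma distributive (E : I -> set (set nat)) (A0 : set nat) :
  unbounded A0 ->
  (forall i A A', E i A -> unbounded A' -> ae A' A -> E i A') ->
  (forall i A, unbounded A -> A `<=` A0 ->
    exists A', [/\ unbounded A', A' `<=` A & E i A']) ->
  exists P, [/\ unbounded P, P `<=` A0 & forall i, E i P].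
Proof.
move=> A0u Eopen Edense; have [lti ltt lttot ltmin] := lt_wo.
pose S i (h : I -> set nat) q :=
  [/\ unbounded q, ae q A0, E i q & forall j, lt j i -> ae q (h j)].
have [|i h h' q hh' [? ? ? H]|i h Sh|h hP] :=
  @wf_recursion _ _ set0 lt S (strict_wo_wf lt_wo).
- exact: ltt.
- by split => // j ji; rewrite -hh'//; exact: H.
- have [||||P [Pu PA0 Ph]] :=
    @tower_pseudointersection _ lt (below lt i) A0 h lt_wo I_tower.
  + exact: A0u.
  + by move=> j /Sh[].
  + by move=> j /Sh[].
  + by move=> j k /Sh[_ _ _ H] _; exact: H.
  have [A' [A'u A'P EA']] := Edense i P Pu PA0.
  exists A'; split => //; first exact: sub_ae (subset_trans A'P PA0).
  by move=> j ji; apply: ae_trans (Ph j ji); exact: sub_ae.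
have [||||P [Pu PA0 Ph]] := @tower_pseudointersection _ lt setT A0 h lt_wo I_tower.
- exact: A0u.
- by move=> j _; have [] := hP j.
- by move=> j _; have [] := hP j.
- by move=> i j _ _; have [_ _ _ H] := hP i; exact: H.
exists P; split => // i.
by have [_ _ Ei _] := hP i; apply: Eopen Ei _ _ => //; exact: Ph.
Qed.

(* A sufficiently sparse set bounds f at each of its points by its next
   point. *)
Lemma dominating (f : I -> nat -> nat) (A : set nat) : unbounded A ->
  exists B h, [/\ unbounded B, B `<=` A &
    forall i, ae B [set n | f i n <= h n]].
Proof.
move=> Au.
pose E i (X : set nat) := ae X [set n | forall m, X m -> n < m -> f i n <= m].
have [|||P [Pu PA EP]] := @distributive E A.
- exact: Au.
- move=> i X X' [N EX] _ [M XX']; exists (maxn N M) => n.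
  rewrite geq_max => /andP[Nn Mn] X'n m X'm nm; apply: EX => //.
    exact: XX'.
  by apply: XX' => //; exact: leq_trans (ltnW nm).
- move=> i X Xu _.
  have /choice[nx nxP] : forall N, exists n, N <= n /\ X n.
    by move=> N; have [n Nn Xn] := Xu N; exists n.
  have /choice[b bP] : forall k, exists K, forall n, n < k.+1 -> f i n < K.
    by move=> k; exact: bounded_image.
  pose g := fix g k := if k is k'.+1 then nx (maxn (g k').+1 (b (g k'))) else nx 0.
  have gX k : X (g k) by case: k => [|k]; exact: proj2 (nxP _).
  have gS k : g k < g k.+1 /\ b (g k) <= g k.+1.
    by have [/= + _] := nxP (maxn (g k).+1 (b (g k))); rewrite geq_max => /andP[].
  have gmono k l : k < l -> g k.+1 <= g l.
    elim: l => // l IH; rewrite ltnS leq_eqVlt => /orP[/eqP->//|/IH].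
    by move=> /leq_trans; apply; exact: ltnW (proj1 (gS l)).
  exists (range g); split.
  + apply: unbounded_range => k l; case: (ltngtP k l) => // /gmono kl e.
      by move: (proj1 (gS k)); rewrite e ltnNge kl.
    by move: (proj1 (gS l)); rewrite -e ltnNge kl.
  + by move=> _ [k _ <-].
  + exists 0 => _ _ [k _ <-] _ [l _ <-] kl.
    have /gmono kl' : k < l.
      rewrite ltnNge leq_eqVlt; apply/negP => /orP[/eqP lk|/gmono lk].
        by rewrite lk ltnn in kl.
      by move: (leq_trans (leq_trans (proj1 (gS l)) lk) (ltnW kl)); rewrite ltnn.
    apply: leq_trans kl'; apply: leq_trans (proj2 (gS k)).
    by apply: ltnW; exact: bP.
have /choice[h hP] : forall n, exists m, n < m /\ P m.
  by move=> n; have [m nm Pm] := Pu n.+1; exists m.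
exists P, h; split => // i; apply: aeS (EP i) => n H.
by have [nh Ph] := hP n; exact: H.
Qed.

(* Unlike in [saturation], the conditions are indexed by all of I: they are
   decreasing, so that #|I| < t suffices. *)
Lemma tree_top (T : countType) (A : set nat) (Y : I -> nat -> set T)
    (c : I -> nat -> T) : unbounded A ->
  (forall i, ae A [set n | Y i n (c i n)]) ->
  (forall i j, lt j i -> ae A [set n | Y i n `<=` Y j n]) ->
  exists B d, [/\ unbounded B, B `<=` A & forall i, ae B [set n | Y i n (d n)]].
Proof.
move=> Au Yc Ydec.
have [A1 [h [A1u A1A hP]]] := dominating (fun i n => pickle (c i n)) Au.
have toA1 P : ae A P -> ae A1 P by apply: ae_trans; exact: sub_ae.
pose base n (x : T) := A1 n /\ pickle x <= h n.
pose X i n (x : T) := base n x /\ Y i n x.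
(* The bound [h] makes the columns of [base] finite. Large codes therefore lie in far columns, and a
   property of almost all columns becomes one of almost all codes. *)
have col N : exists K, forall n x, base n x -> K <= pickle (n, x) -> N <= n.
  have [K KP] := bounded_image2
    (fun n m => if unpickle m is Some x then pickle (n, x : T) else 0) h N.
  exists K => n x [_ xh] Kp; rewrite leqNgt; apply/negP => nN.
  by have := KP n _ nN xh; rewrite pickleK ltnNge Kp.
have cX i : ae A1 [set n | X i n (c i n)].
  by apply: aeS (ae_in (aeI (toA1 _ (Yc i)) (hP i))) => n [An [Yn hn]].
have basec : unbounded (graph base).
  apply: (@unbounded_graph _ _ _ (unbounded_ae A1u (cX i0))).
  by move=> n [_ [? _]]; exists (c i0 n).
have [|||P [Pu Pb PX]] := tower_pseudointersection (D := setT) (A := fun i => graph (X i))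
    lt_wo I_tower basec.
- move=> i _; apply: (@unbounded_graph _ _ _ (unbounded_ae A1u (cX i))).
  by move=> n [_ ?]; exists (c i n).
- move=> i _; apply: sub_ae => _ [n [x [-> [? _]]]].
  exact/graphE.
- move=> i j _ _ /Ydec/toA1[N Yij]; have [K KP] := col N.
  exists K => p Kp [n [x [pE [bx Yx]]]]; rewrite pE in Kp *.
  have Nn := KP _ _ bx Kp.
  by apply/graphE; split => //; apply: Yij => //; case: bx.
have [x0 _] : exists x0 : T, True by exists (c i0 0).
pose d (n : nat) : T := xget x0 [set x | P (pickle (n, x))].
have dP n : (exists y : T, P (pickle (n, y))) -> P (pickle (n, d n)).
  exact: (@xgetPex _ x0 [set x | P (pickle (n, x))]).
exists [set n | exists y : T, P (pickle (n, y))], d; split.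
- move=> N; have [K KP] := col N; have [p Kp Pp] := Pu K.
  have [n [x [pE bx]]] := Pb _ Pp.
  by exists n; [apply: (KP n x) => //; rewrite -pE|exists x; rewrite -pE].
- by move=> n [y /Pb/graphE[/A1A]].
- move=> i; have [M PXi] := PX i Logic.I; have [K KP] := pickle_column T M.
  exists K => n Kn /dP Pd.
  by have /graphE[] := PXi _ (KP n _ Kn) Pd.
Qed.

(** This holds when [I] has the least cardinality of a family with infinite finite meets and no
    infinite pseudointersection. *)
Hypothesis saturated : forall F : set (set nat), ~ ([set: I] #<= F) ->
  (forall s : seq (set nat), (forall A, A \in s -> F A) ->
     unbounded [set n | forall A, A \in s -> A n]) ->
  exists2 P, unbounded P & forall A, F A -> ae P A.
Hypothesis I_uncountable : ~ countable [set: I].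

(** Saturation of a reduced power: fewer than #|I| conditions, finitely satisfiable almost
    everywhere, are realised by one function on an infinite set. A pseudointersection of the graphs
    of the conditions selects its values. *)
Lemma saturation (T : countType) (D : set I) (A : set nat)
    (X : I -> nat -> set T) : ~ ([set: I] #<= D) -> unbounded A ->
  (forall s : seq I, (forall i, i \in s -> D i) ->
     ae A [set n | exists x, forall i, i \in s -> X i n x]) ->
  exists B c, [/\ unbounded B, B `<=` A &
    forall i, D i -> ae B [set n | X i n (c n)]].
Proof.
move=> Dsmall Au Xfin.
(* These countably many extra conditions prevent a pseudointersection from staying in finitely many
   columns. Adding them keeps the family smaller than [I], which is uncountable. *)
pose Z m n (x : T) := A n /\ m <= n.
pose Y i n (x : T) := A n /\ X i n x.
pose F := ((fun i => graph (Y i)) @` D) `|` range (fun i => graph (Z i)).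
have Fsmall : ~ ([set: I] #<= F).
  move=> IF.
  have [F1fin|F1inf] := pselect (finite_set ((fun i => graph (Y i)) @` D)).
    apply: I_uncountable; apply: (sub_countable IF).
    apply: countable_setU; [exact: finite_set_countable|exact: card_image_le].
  apply: Dsmall; apply: (card_le_trans IF).
  apply: (card_le_trans _ (card_image_le (fun i => graph (Y i)) D)).
  apply: card_setU_infinite => //; apply: (card_le_trans (card_image_le _ _)).
  exact/infiniteP.
have Ffin (s : seq (set nat)) : (forall E, E \in s -> F E) -> exists (t : seq I) m,
    (forall i, i \in t -> D i) /\ forall n x, A n -> m <= n ->
    (forall i, i \in t -> X i n x) -> forall E, E \in s -> E (pickle (n, x)).
  elim: s => [|E s IH] Fs; first by exists [::], 0.
  have [|t [m [tD tP]]] := IH; first by move=> E' E's; apply: Fs; rewrite inE E's orbT.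
  have [[i Di <-]|[k _ <-]] := Fs E (mem_head _ _).
    exists (i :: t), m; split.
      by move=> j; rewrite inE => /orP[/eqP->//|]; exact: tD.
    move=> n x An mn Xn E'; rewrite inE => /orP[/eqP->|].
      by apply/graphE; split => //; apply: Xn; rewrite mem_head.
    by apply: tP => // j jt; apply: Xn; rewrite inE jt orbT.
  exists t, (maxn m k); split => // n x An; rewrite geq_max => /andP[mn kn] Xn E'.
  rewrite inE => /orP[/eqP->|]; first exact/graphE.
  exact: tP.
have [|P Pu PF] := saturated Fsmall.
  move=> s /Ffin[t [m [tD tP]]].
  pose W n (x : T) := m <= n /\ A n /\ forall i, i \in t -> X i n x.
  apply: (@unboundedS (graph W)).
    by move=> _ [n [x [-> [mn [An Xn]]]]] E; exact: tP.
  have Wu := unbounded_ae Au (aeI (ae_large A m) (Xfin t tD)).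
  by apply: (unbounded_graph Wu) => n [An [mn [x Xn]]]; exists x.
have PZ m : ae P (graph (Z m)) by apply: PF; right; exists m.
have [x0 _] : exists x0 : T, True.
  have [N PN] := PZ 0; have [p Np Pp] := Pu N.
  by have [n [x _]] := PN p Np Pp; exists x.
pose c (n : nat) : T := xget x0 [set x | P (pickle (n, x))].
have cP n : (exists y : T, P (pickle (n, y))) -> P (pickle (n, c n)).
  exact: (@xgetPex _ x0 [set x | P (pickle (n, x))]).
exists [set n | A n /\ exists y : T, P (pickle (n, y))], c; split.
- move=> N; have [M PM] := PZ N; have [p Mp Pp] := Pu M.
  have [n [x [pE [An Nn]]]] := PM p Mp Pp.
  by exists n => //; split => //; exists x; rewrite -pE.
- by move=> n [].
- move=> i Di.
  have [M PXi] : ae P (graph (Y i)) by apply: PF; left; exists i.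
  have [K KP] := pickle_column T M.
  exists K => n Kn [_ /cP Pc].
  by have /graphE[] := PXi _ (KP n _ Kn) Pc.
Qed.

(* The finite traces of a decreasing chain on the intervals ]n, h n] become the
   level sets of one rank function on each interval. *)
Lemma rank_function (D : set I) (C : I -> set nat) (A : set nat) (h : nat -> nat) :
  ~ ([set: I] #<= D) -> unbounded A ->
  (forall i j, D i -> D j -> lt j i -> ae (C i) (C j)) ->
  exists B r, [/\ unbounded B, B `<=` A & forall j, D j -> ae B [set n |
    exists k, forall x, n < x <= h n -> C j x <-> k <= r n x]].
Proof.
move=> Dsmall Au Cdec; have [_ _ lttot _] := lt_wo.
pose X j n (c : seq nat) := exists k, forall x, n < x <= h n ->
  C j x <-> k <= nth 0 c x.
pose sub n i j := forall x, n < x -> C i x -> C j x.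
have [|B [c [Bu BA cX]]] := @saturation _ D A X Dsmall Au; last first.
  by exists B, (fun n => nth 0 (c n)).
move=> s sD.
have : ae A [set n | forall i, i \in s -> forall j, j \in s -> sub n i j \/ sub n j i].
  apply: ae_all => i /sD Di; apply: (ae_all (P := fun j => _)) => j /sD Dj.
  have aux i' j' : ae (C i') (C j') -> ae A [set n | sub n i' j'].
    move=> [N CN]; exists N => n Nn _ x nx; apply: CN.
    exact: leq_trans (ltnW nx).
  have [ij|->|ji] := lttot i j.
  - by apply: aeS (aux _ _ (Cdec _ _ Dj Di ij)) => n; right.
  - by exists 0 => n _ _; left.
  - by apply: aeS (aux _ _ (Cdec _ _ Di Dj ji)) => n; left.
apply: aeS => n chain.
(* The rank of [x] counts the sets containing it, and the threshold of [j] counts those including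
   [C j] beyond [n]. A point outside [C j] lies only in sets including [C j], and not in [C j]
   itself, so its rank is smaller. *)
exists (mkseq (fun x => count (fun i => `[< C i x >]) s) (h n).+1) => j js.
exists (count (fun i => `[< sub n j i >]) s) => x /andP[nx xh].
rewrite nth_mkseq//; split=> [Cx|].
  by apply: sub_count => i /asboolP; move=> /(_ x nx Cx) ?; apply/asboolP.
apply: contraPP => nCx; apply/negP; rewrite -ltnNge.
apply: (@count_lt _ _ _ _ j) => //.
- move=> i si /asboolP Cix; apply/asboolP.
  by have [//|/(_ x nx Cix)] := chain j js i si.
- by apply/asboolP => y.
- exact/asboolPn.
Qed.

(** * From a chain that cannot be continued to an unfilled cut *)

Hypothesis I_infinite : infinite_set [set: I].
Hypothesis below_small : forall i, ~ ([set: I] #<= below lt i).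

(** On each interval ]n, h n] the chain is replaced by thresholds [k j n] of a rank, and [B b] by
    the greatest rank [f b n] of its points there. A function between the two would give a set
    continuing the chain. *)
Lemma chain_cut (D : set I) (m : I) (C B : I -> set nat) :
  D `<=` below lt m -> (forall b, unbounded (B b)) ->
  (forall i j, D i -> D j -> lt j i -> ae (C i) (C j)) ->
  (forall j b, D j -> unbounded (C j `&` B b)) ->
  ~ (exists A, (forall j, D j -> ae A (C j)) /\
               forall b, unbounded (A `&` B b)) ->
  exists A d e, [/\ unbounded A,
    forall i j, D i -> D j -> lt j i -> ae A [set n | d j n <= d i n],
    forall i j, lt j i -> ae A [set n | e i n <= e j n],
    forall i j, D j -> ae A [set n | d j n <= e i n] &
    forall A' u, unbounded A' -> A' `<=` A ->
      (forall j, D j -> ae A' [set n | d j n <= u n]) ->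
      (forall i, ae A' [set n | u n <= e i n]) -> False].
Proof.
move=> Dm Bu Cdec CB nofill; have [lti ltt lttot ltmin] := lt_wo.
have Dsmall : ~ ([set: I] #<= D).
  move=> /card_le_trans IDm; apply: (@below_small m); apply: IDm.
  exact: subset_card_le.
have /choice[w wP] : forall p : I * I * nat, exists x, D p.1.1 ->
    [/\ p.2 < x, C p.1.1 x & B p.1.2 x].
  move=> [[j b] n] /=; have [Dj|nD] := pselect (D j); last by exists 0.
  by have [x nx []] := CB j b Dj n.+1; exists x.
(* The witnesses are indexed by pairs; enumerating the pairs by [I] lets one function [h] bound all
   of them. *)
have [sp [_ spP]] : exists f : I -> I * I, (forall y, [set: I * I] (f y)) /\
    forall x, [set: I * I] x -> exists2 y, [set: I] y & f y = x.
  apply: card_cover; first by exists (i0, i0).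
  by rewrite -setXTT; exact: card_square.
have setTu : unbounded setT by move=> N; exists N.
have [A0 [h [A0u _ hP]]] := dominating (fun i n => w (sp i, n)) setTu.
have wh j b : ae A0 [set n | w (j, b, n) <= h n].
  by have [i _ spi] := spP (j, b) Logic.I; have := hP i; rewrite spi.
have [A1 [r [A1u A10 rP]]] := rank_function h Dsmall A0u Cdec.
have toA1 P : ae A0 P -> ae A1 P by apply: ae_trans; exact: sub_ae.
(* Taking the least sound threshold defines [k j] at every [n] and, through [kmin], makes it grow
   modulo finite as [C j] shrinks. *)
have /choice[k0 k0P] : forall p : I * nat, exists k,
    (forall x, p.2 < x <= h p.2 -> k <= r p.2 x -> C p.1 x) /\
    forall k', (forall x, p.2 < x <= h p.2 -> k' <= r p.2 x -> C p.1 x) -> k <= k'.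
  move=> [j n] /=; apply: nat_least.
  have [K KP] := bounded_image (r n) (h n).+1; exists K => x /andP[_ xh].
  by rewrite leqNgt KP.
pose k j n := k0 (j, n).
have kC j n x : n < x <= h n -> k j n <= r n x -> C j x.
  exact: (proj1 (k0P (j, n))).
have kmin j n k' : (forall x, n < x <= h n -> k' <= r n x -> C j x) -> k j n <= k'.
  exact: (proj2 (k0P (j, n))).
have kr j : D j -> ae A1 [set n | forall x, n < x <= h n -> C j x -> k j n <= r n x].
  move=> /rP; apply: aeS => n [k' k'P] x xn Cx.
  apply: leq_trans (proj1 (k'P x xn) Cx).
  by apply: kmin => y yn /(proj2 (k'P y yn)).
have /choice[f0 f0P] : forall p : I * nat, exists v,
    (exists x, p.2 < x <= h p.2 /\ B p.1 x) ->
    (exists x, [/\ p.2 < x <= h p.2, B p.1 x & v = r p.2 x]) /\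
    forall x, p.2 < x <= h p.2 -> B p.1 x -> r p.2 x <= v.
  move=> [b n] /=.
  have [[x [xn Bx]]|nx] := pselect (exists x, n < x <= h n /\ B b x); last by exists 0.
  have [K KP] := bounded_image (r n) (h n).+1.
  have [||v [[y [yn By ->]] vmax]] := @nat_greatest
      (fun v => exists x, [/\ n < x <= h n, B b x & v = r n x]) K.
  - by exists (r n x), x.
  - by move=> _ [y [/andP[_ yh] _ ->]]; exact: ltnW (KP _ _).
  by exists (r n y) => _; split; [exists y|move=> z zn Bz; apply: vmax; exists z].
pose f b n := f0 (b, n).
have fP j b : D j -> ae A1 [set n | k j n <= f b n /\
    exists x, [/\ n < x <= h n, B b x & f b n = r n x]].
  move=> Dj; apply: aeS (aeI (kr j Dj) (toA1 _ (wh j b))) => n [krn whn].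
  have [/= nw Cw Bw] := wP (j, b, n) Dj.
  have [|fx fmax] := f0P (b, n); first by exists (w (j, b, n)); rewrite nw.
  split => //; apply: (@leq_trans (r n (w (j, b, n)))).
    by apply: krn => //; rewrite nw.
  by apply: fmax => //=; rewrite nw.
have [j0 Dj0] : D !=set0.
  apply: contrapT => D0; apply: nofill; exists setT; split=> [j Dj|b].
    by case: D0; exists j.
  by rewrite setTI.
(* The forbidden set consists of the points of rank at least [u n] in the intervals ]n, h n] with
   [n] in [A']. *)
have nof A' u : unbounded A' -> A' `<=` A1 ->
    (forall j, D j -> ae A' [set n | k j n <= u n]) ->
    (forall i, ae A' [set n | u n <= f i n]) -> False.
  move=> A'u A'1 ku uf; apply: nofill.
  exists [set x | exists n, [/\ A' n, n < x <= h n & u n <= r n x]]; split.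
    move=> j Dj; have [N kuN] := ku j Dj; have [K KP] := bounded_image h N.
    exists K => x Kx [n [A'n xn ux]]; apply: (kC j n) => //.
    apply: leq_trans ux; apply: kuN => //; rewrite leqNgt; apply/negP => /KP.
    by case/andP: xn => _ /(leq_trans Kx); rewrite leqNgt => /negP.
  move=> b N.
  have fA' : ae A' [set n | exists x, [/\ n < x <= h n, B b x & f b n = r n x]].
    by apply: ae_trans (sub_ae A'1) _; apply: aeS (fP j0 b Dj0) => n [].
  have [n Nn [A'n [[x [/andP[nx xh] Bx fx]] un]]] := unbounded_ae A'u (aeI fA' (uf b)) N.
  exists x; first exact: leq_trans (ltnW nx).
  by split => //; exists n; rewrite -fx nx xh.
(* The functions [f b] need not be monotone in [b]. The recursion interpolates a decreasing
   sequence: its term at [i] is above all [k j], below [f i] and below the earlier terms. *)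
pose S i (H : I -> set nat * (nat -> nat)) (q : set nat * (nat -> nat)) :=
  [/\ unbounded q.1, q.1 `<=` A1,
      forall j, D j -> ae q.1 [set n | k j n <= q.2 n],
      ae q.1 [set n | q.2 n <= f i n] &
      forall j, lt j i -> ae q.1 (H j).1 /\ ae q.1 [set n | q.2 n <= (H j).2 n]].
have [|i H H' q HH' [? ? ? ? HP]|i H SH|H HP] :=
  @wf_recursion _ _ (set0, id) lt S (strict_wo_wf lt_wo).
- exact: ltt.
- by split => // j ji; rewrite -HH'//; exact: HP.
- have [||||P [Pu PA1 PH]] :=
    @tower_pseudointersection _ lt (below lt i) A1 (fst \o H) lt_wo I_tower.
  + exact: A1u.
  + by move=> j /SH[].
  + by move=> j /SH[_ ? _ _ _]; exact: sub_ae.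
  + by move=> j l /SH[_ _ _ _ Hl] _ /Hl[].
  pose X j n x := [/\ D j -> k j n <= x, lt j i -> x <= (H j).2 n & x <= f i n].
  (* [D] and the predecessors of [i] both lie below the larger of [m] and [i], so together they are
     still small. *)
  have [M [DM iM] Msmall] : exists2 M : set I, D `<=` M /\ below lt i `<=` M &
      ~ ([set: I] #<= M).
    have [im|->|mi] := lttot i m.
    + exists (below lt m) => //; split => // j ji; exact: ltt im.
    + by exists (below lt m) => //; split => // j.
    + exists (below lt i) => //; split => // j /Dm jm; exact: ltt mi.
  have [|B' [c [B'u B'P cX]]] := @saturation _ M P X Msmall Pu.
    move=> s sM.
    have : ae P [set n | forall j, j \in s -> forall l, l \in s ->
        (D j -> k j n <= f i n) /\ (D j -> lt l i -> k j n <= (H l).2 n)].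
      apply: ae_all => j js; apply: (ae_all (P := fun l => _)) => l ls.
      apply: (aeI (P := fun n => D j -> _)).
        have [Dj|nD] := pselect (D j); last by exists 0.
        apply: aeS (ae_trans (sub_ae PA1) (fP j i Dj)) => n [? _] //.
      have [Dj|nD] := pselect (D j); last by exists 0.
      have [li|nli] := pselect (lt l i); last by exists 0.
      have [_ _ kH _ _] := SH l li.
      by apply: aeS (ae_trans (PH l li) (kH j Dj)) => n ? _ _.
    apply: aeS => n bnd; exists (\max_(j <- s | `[< D j >]) k j n) => l ls; split.
    + by move=> Dl; apply: leq_bigmax_seq => //; apply/asboolP.
    + move=> li; apply/bigmax_leqP_seq => j js /asboolP Dj.
      by have [_] := bnd j js l ls; apply.
    + apply/bigmax_leqP_seq => j js /asboolP Dj.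
      by have [+ _] := bnd j js l ls; apply.
  exists (B', c); split => //=.
  + exact: subset_trans B'P PA1.
  + by move=> j Dj; apply: aeS (cX j (DM _ Dj)) => n [+ _ _]; apply.
  + by apply: aeS (cX j0 (DM _ Dj0)) => n [].
  + move=> j ji; split; first exact: ae_trans (sub_ae B'P) (PH j ji).
    by apply: aeS (cX j (iM _ ji)) => n [_ + _]; apply.
have [||||P [Pu PA1 PH]] :=
  @tower_pseudointersection _ lt setT A1 (fst \o H) lt_wo I_tower.
- exact: A1u.
- by move=> i _; have [] := HP i.
- by move=> i _; have [_ ? _ _ _] := HP i; exact: sub_ae.
- by move=> i j _ _ ji; have [_ _ _ _ /(_ j ji)[]] := HP i.
have PH' i : ae P (H i).1 by exact: PH.
exists P, k, (fun i => (H i).2); split => //.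
- move=> i j Di Dj /(Cdec i j Di Dj)[N CN]; exists N => n Nn _.
  apply: kmin => x /andP[nx xh] /(kC i n x) Cx.
  by apply: CN; [exact: leq_trans (ltnW nx)|apply: Cx; rewrite nx].
- move=> i j ji; have [_ _ _ _ /(_ j ji)[_]] := HP i; exact: ae_trans.
- by move=> i j Dj; have [_ _ /(_ j Dj) + _ _] := HP i; apply: ae_trans.
- move=> A' u A'u A'P ku ue; apply: (nof A' u) => //.
    exact: subset_trans PA1.
  move=> i; have [_ _ _ fi _] := HP i.
  have A'H : ae A' (H i).1 by exact: ae_trans (sub_ae A'P) (PH' i).
  by apply: aeS (aeI (ue i) (ae_trans A'H fi)) => n [] /leq_trans; apply.
Qed.

Lemma seq_max (s : seq I) : s != [::] ->
  exists2 b, b \in s & forall i, i \in s -> lt i b \/ i = b.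
Proof.
have [lti ltt lttot ltmin] := lt_wo.
elim: s => // x [_ _|y s /(_ isT)[b bs bmax] _].
  by exists x; [rewrite mem_head|move=> i; rewrite inE => /eqP; right].
have [xb|xb|bx] := lttot x b.
- exists b; first by rewrite inE bs orbT.
  by move=> i; rewrite inE => /orP[/eqP->|/bmax//]; left.
- exists b; first by rewrite inE bs orbT.
  by move=> i; rewrite inE => /orP[/eqP->|/bmax//]; right.
- exists x; first by rewrite mem_head.
  move=> i; rewrite inE => /orP[/eqP->|/bmax[ib|->]]; first by right.
    by left; exact: ltt bx.
  by left.
Qed.

(** * Unfilled cuts are impossible *)

Section cut.
Variables (D : set I) (A : set nat) (d e : I -> nat -> nat).
Hypothesis Dinf : infinite_set D.
Hypothesis Dsmall : ~ ([set: I] #<= D).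
Hypothesis Dmin : forall i, D i -> ~ (D #<= below lt i).
Hypothesis Au : unbounded A.
Hypothesis dmono : forall i j, D i -> D j -> lt j i ->
  ae A [set n | d j n <= d i n].
Hypothesis emono : forall i j, lt j i -> ae A [set n | e i n <= e j n].
Hypothesis de : forall i j, D j -> ae A [set n | d j n <= e i n].
Hypothesis nofill : forall A' u, unbounded A' -> A' `<=` A ->
  (forall j, D j -> ae A' [set n | d j n <= u n]) ->
  (forall i, ae A' [set n | u n <= e i n]) -> False.

(* The successor cardinal of #|D|, as an initial segment. *)
Let succD : set I := [set i | below lt i #<= D].

Lemma succD_below i j : succD i -> lt j i -> succD j.
Proof.
have [_ ltt _ _] := lt_wo => iS ji; apply: card_le_trans iS.
by apply: subset_card_le => k kj; exact: ltt ji.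
Qed.

(** Otherwise the least index outside [succD] has all its predecessors in [succD], hence at most
    #|D| of them, and belongs to [succD]. *)
Lemma succD_not_le : ~ (succD #<= D).
Proof.
have [_ _ _ ltmin] := lt_wo => SD.
have [|i iS imin] := ltmin (~` succD).
  apply: contrapT => /set0P/negP/negPn/eqP/(congr1 setC).
  rewrite setCK setC0 => ST; apply: Dsmall; by rewrite -ST.
apply: iS; apply: card_le_trans SD; apply: subset_card_le => j ji.
by apply: contrapT => jS; exact: (imin j).
Qed.

(** The code at [c] must exceed each earlier one and have a prescribed colour with it. Finitely many
    earlier codes are distinct at almost every [n], so [code_exists] meets finitely many demands and
    saturation meets all of them. *)
Lemma cut_codes (g : I -> I -> I) :
  (forall c b, succD c -> lt b c -> D (g c b)) ->
  exists B (y : I -> nat -> nat), [/\ unbounded B, B `<=` A &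
    forall b c, succD c -> lt b c -> ae B [set n | y b n < y c n /\
      app_code (y b n) (y c n) = d (g c b) n]].
Proof.
move=> gD; have [lti ltt lttot ltmin] := lt_wo.
pose S c (H : I -> set nat * (nat -> nat)) (q : set nat * (nat -> nat)) :=
  [/\ unbounded q.1, q.1 `<=` A &
    forall b, lt b c -> ae q.1 (H b).1 /\ (succD c ->
      ae q.1 [set n | (H b).2 n < q.2 n /\
        app_code ((H b).2 n) (q.2 n) = d (g c b) n])].
have [|c H H' q HH' [? ? HP]|c H SH|H HP] :=
  @wf_recursion _ _ (set0, id) lt S (strict_wo_wf lt_wo).
- exact: ltt.
- by split => // b bc; rewrite -HH'//; exact: HP.
- have [||||P [Pu PA PH]] :=
    @tower_pseudointersection _ lt (below lt c) A (fst \o H) lt_wo I_tower.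
  + exact: Au.
  + by move=> j /SH[].
  + by move=> j /SH[_ ? _]; exact: sub_ae.
  + by move=> j l /SH[_ _ Hl] _ /Hl[].
  have [cS|ncS] := pselect (succD c); last first.
    (* Outside [succD] no code is demanded: [id] is a filler and only the sets go on decreasing. *)
    by exists (P, id); split => // b bc; split => //; exact: PH.
  pose X b n z := (H b).2 n < z /\ app_code ((H b).2 n) z = d (g c b) n.
  have [|B [z [Bu BP zX]]] := @saturation _ (below lt c) P X (@below_small c) Pu.
    move=> s sc.
    have : ae P [set n | forall b, b \in s -> forall b', b' \in s ->
        lt b b' -> (H b).2 n < (H b').2 n].
      apply: ae_all => b bs; apply: (ae_all (P := fun b' => _)) => b' b's.
      have [bb'|nbb'] := pselect (lt b b'); last by exists 0.
      have [_ _ /(_ b bb')[_ /(_ (succD_below cS (sc _ b's)))]] := SH b' (sc _ b's).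
      by move=> /(ae_trans (PH b' (sc _ b's))); apply: aeS => n [].
    apply: aeS => n ys; apply: code_exists => b b' bs b's.
    have [bb'|//|b'b] := lttot b b'.
      by move: (ys _ bs _ b's bb') => /[swap] ->; rewrite ltnn.
    by move: (ys _ b's _ bs b'b) => /[swap] ->; rewrite ltnn.
  exists (B, z); split => //=; first exact: subset_trans BP PA.
  move=> b bc; split; first exact: ae_trans (sub_ae BP) (PH b bc).
  by move=> _; exact: zX.
have [||||P [Pu PA PH]] :=
  @tower_pseudointersection _ lt setT A (fst \o H) lt_wo I_tower.
- exact: Au.
- by move=> i _; have [] := HP i.
- by move=> i _; have [_ ? _] := HP i; exact: sub_ae.
- by move=> i j _ _ ji; have [_ _ /(_ j ji)[]] := HP i.
exists P, (fun i => (H i).2); split => // b c cS bc.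
have [_ _ /(_ b bc)[_ /(_ cS)]] := HP c.
by apply: ae_trans; exact: PH.
Qed.

(* The node built at stage i prescribes N_a for a >= e_i; N_a is then kept, and
   the values between e_j and e_i are chosen at later stages j. *)
Lemma cut_nodes (g : I -> I -> I) (B : set nat) (y : I -> nat -> nat) :
  (forall c b, succD c -> lt b c -> D (g c b)) ->
  unbounded B -> B `<=` A ->
  (forall b c, succD c -> lt b c -> ae B [set n | y b n < y c n /\
      app_code (y b n) (y c n) = d (g c b) n]) ->
  exists B' (N : nat -> seq (seq nat)), [/\ unbounded B', B' `<=` B &
    forall i c, succD c -> ae B' [set n | forall a, e i n <= a < e c n ->
      y c n \in nth [::] (N n) a /\ bounded_clique a (nth [::] (N n) a)]].
Proof.
move=> gD Bu BA yP; have [lti ltt lttot ltmin] := lt_wo.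
have toB P Q : P `<=` B -> ae A Q -> ae P Q.
  by move=> PB; apply: ae_trans; exact: sub_ae (subset_trans PB BA).
pose valid (N : seq (seq nat)) := forall a, bounded_clique a (nth [::] N a).
pose agree a0 (N M : seq (seq nat)) :=
  forall a, a0 <= a -> nth [::] N a = nth [::] M a.
pose S i (H : I -> set nat * (nat -> seq (seq nat)))
    (q : set nat * (nat -> seq (seq nat))) :=
  [/\ unbounded q.1, q.1 `<=` B, forall n, valid (q.2 n) &
    forall b, lt b i -> [/\ ae q.1 (H b).1,
      ae q.1 [set n | agree (e b n) (q.2 n) ((H b).2 n)] &
      succD b -> ae q.1 [set n | forall a, e i n <= a < e b n ->
        y b n \in nth [::] (q.2 n) a]]].
have [|i H H' q HH' [? ? ? HP]|i H SH|H HP] :=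
  @wf_recursion _ _ (set0, fun=> [::]) lt S (strict_wo_wf lt_wo).
- exact: ltt.
- by split => // b bi; rewrite -HH'//; exact: HP.
- have [||||P [Pu PB PH]] :=
    @tower_pseudointersection _ lt (below lt i) B (fst \o H) lt_wo I_tower.
  + exact: Bu.
  + by move=> j /SH[].
  + by move=> j /SH[_ ? _ _]; exact: sub_ae.
  + by move=> j l /SH[_ _ _ Hl] _ /Hl[].
  pose X b n N := [/\ valid N, agree (e b n) N ((H b).2 n) &
    succD b -> forall a, e i n <= a < e b n -> y b n \in nth [::] N a].
  have [|B' [N [B'u B'P NX]]] := @saturation _ (below lt i) P X (@below_small i) Pu.
    move=> s si.
    have [s0|s0] := eqVneq s [::].
      by exists 0 => n _ _; exists [::]; rewrite s0.
    (* Among finitely many stages, the node at the latest one, [b], already agrees with the others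
       above their bounds; only values below e_b are left to choose. *)
    have [b bs bmax] := seq_max s0.
    have [_ _ validH Hb] := SH b (si b bs).
    have cond1 : ae P [set n | forall c, c \in s -> lt c b ->
        [/\ e b n <= e c n, agree (e c n) ((H b).2 n) ((H c).2 n) &
        succD c -> forall a, e b n <= a < e c n -> y c n \in nth [::] ((H b).2 n) a]].
      apply: ae_all => c cs; have [cb|ncb] := pselect (lt c b); last by exists 0.
      have [_ H1 H2] := Hb c cb; have PHb := PH b (si b bs).
      have H2' : ae P [set n | succD c -> forall a, e b n <= a < e c n ->
          y c n \in nth [::] ((H b).2 n) a].
        have [cS|ncS] := pselect (succD c); last by exists 0 => n _ _ /ncS.
        by apply: aeS (ae_trans PHb (H2 cS)) => n + _.
      apply: aeS (aeI (toB P _ PB (emono cb)) (aeI (ae_trans PHb H1) H2')).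
      by move=> n [? [? ?]].
    have cond2 : ae P [set n | forall c, c \in s -> forall c', c' \in s ->
        succD c' -> lt c c' -> [/\ y c n < y c' n,
          app_code (y c n) (y c' n) = d (g c' c) n & d (g c' c) n <= e i n]].
      apply: ae_all => c cs; apply: (ae_all (P := fun c' => _)) => c' c's.
      have [cS|ncS] := pselect (succD c'); last by exists 0 => n _ _ /ncS.
      have [cc'|ncc'] := pselect (lt c c'); last by exists 0.
      have yP' := ae_trans (sub_ae PB) (yP c c' cS cc').
      apply: aeS (aeI yP' (toB P _ PB (de i (gD _ _ cS cc')))) => n [[? ?] ?] _ _.
      by split.
    apply: aeS (aeI cond1 cond2) => n [c1 c2].
    (* From e_b on the node at [b] is copied. Between e_i and e_b all relevant codes are put in:
       they form a clique bounded by [a], because their colours are values of [d], which are at most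
       e_i. Below e_i the lists are empty. *)
    pose F a := if e b n <= a then nth [::] ((H b).2 n) a
      else if e i n <= a then [seq y c n | c <- s & `[< succD c >]] else [::].
    pose L := maxn (size ((H b).2 n)) (maxn (e b n) (e i n)).
    have FN a : nth [::] (mkseq F L) a = F a.
      have [aL|La] := ltnP a L; first by rewrite nth_mkseq.
      rewrite nth_default ?size_mkseq//; move: La.
      rewrite !geq_max => /and3P[sa ba _].
      by rewrite /F ba nth_default.
    exists (mkseq F L) => c cs; split.
    + move=> a x z; rewrite FN /F; case: ifP => [_|ba].
        exact: validH.
      case: ifP => // ia /mapP[c1' + ->] /mapP[c2' + ->].
      rewrite !mem_filter => /andP[/asboolP c1S c1s] /andP[/asboolP c2S c2s] y12.
      have [c12|e12|c21] := lttot c1' c2'.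
      * by have [_ -> /leq_trans] := c2 _ c1s _ c2s c2S c12; apply.
      * by rewrite e12 ltnn in y12.
      * have [y21 _ _] := c2 _ c2s _ c1s c1S c21.
        by move: (ltn_trans y12 y21); rewrite ltnn.
    + move=> a ca; have [cb|cb] := bmax c cs; last first.
        by rewrite FN /F -cb ca.
      have [ebc agr _] := c1 c cs cb.
      by rewrite FN /F (leq_trans ebc ca); exact: agr.
    + move=> cS a /andP[ia ac]; rewrite FN /F; case: ifP => ba.
        have [cb|cb] := bmax c cs; last by move: ac; rewrite cb ltnNge ba.
        by have [_ _] := c1 c cs cb; apply => //; rewrite ba.
      rewrite ia; apply/mapP; exists c => //.
      by rewrite mem_filter cs andbT; apply/asboolP.
  (* Saturation gives validity only almost everywhere; the empty node, which is valid, replaces the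
     exceptions. *)
  pose N' n := if pselect (valid (N n)) then N n else [::].
  have N'X b : lt b i -> ae B' [set n | X b n (N' n)].
    move=> /NX; apply: aeS => n XN; have [v _ _] := XN.
    by rewrite /= /N'; case: pselect.
  exists (B', N'); split => //=; first exact: subset_trans B'P PB.
    move=> n; rewrite /N'; case: pselect => [v|nv]; first exact: v.
    move=> a x z.
    by rewrite nth_nil in_nil.
  move=> b bi; split.
  + exact: ae_trans (sub_ae B'P) (PH b bi).
  + by apply: aeS (N'X b bi) => n [].
  + by move=> bS; apply: aeS (N'X b bi) => n [_ _ /(_ bS)].
have [||||P [Pu PB PH]] :=
  @tower_pseudointersection _ lt setT B (fst \o H) lt_wo I_tower.
- exact: Bu.
- by move=> i _; have [] := HP i.
- by move=> i _; have [_ ? _ _] := HP i; exact: sub_ae.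
- by move=> i j _ _ ji; have [_ _ _ /(_ j ji)[]] := HP i.
have PH' i : ae P (H i).1 by exact: PH.
(* There are #|I| conditions, too many for saturation. They decrease with [i], because e_i decreases
   and later nodes agree with earlier ones. *)
have [|||B' [N [B'u B'P NY]]] := @tree_top _ P
    (fun i n N => agree (e i n) N ((H i).2 n)) (fun i => (H i).2).
- exact: Pu.
- by move=> i; exists 0.
- move=> i j ji; have [_ _ _ /(_ j ji)[_ Hij _]] := HP i.
  apply: aeS (aeI (toB P _ PB (emono ji)) (ae_trans (PH' i) Hij)) => n [eij agr] N NH.
  by move=> a ja; rewrite NH ?agr//; exact: leq_trans ja.
exists B', N; split => //; first exact: subset_trans B'P PB.
move=> i c cS.
have [ci|nci] := pselect (lt c i); last first.
  have : ae B' [set n | e c n <= e i n].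
    have [/nci//|ci|ic] := lttot c i; first by rewrite ci; apply: sub_ae => n _ /=.
    exact: toB (subset_trans B'P PB) (emono ic).
  apply: aeS => n eci a /andP[ia ac].
  by move: (leq_trans (leq_ltn_trans ia ac) eci); rewrite ltnn.
have [_ _ validH /(_ c ci)[_ _ /(_ cS) Hc]] := HP i.
have B'H : ae B' (H i).1 by exact: ae_trans (sub_ae B'P) (PH' i).
apply: aeS (aeI (NY i) (ae_trans B'H Hc)) => n [agr yN] a ac.
have /andP[ia _] := ac.
by rewrite (agr a ia); split; [exact: yN|exact: validH].
Qed.

Lemma no_cut : False.
Proof.
have [lti ltt lttot ltmin] := lt_wo.
have /choice[g gP] : forall c, exists f : I -> I, succD c ->
    (forall b, lt b c -> D (f b)) /\
    forall b b', lt b c -> lt b' c -> f b = f b' -> b = b'.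
  move=> c; have [cS|ncS] := pselect (succD c); last by exists id => /ncS.
  by have [f fD finj] := card_le_fun i0 cS; exists f.
have gD c b : succD c -> lt b c -> D (g c b) by move=> /gP[+ _]; apply.
have [B [y [Bu BA yP]]] := cut_codes gD.
have [B' [N [B'u B'B NP]]] := cut_nodes gD Bu BA yP.
have B'A := subset_trans B'B BA.
pose good c n a := forall a', a <= a' < e c n ->
  y c n \in nth [::] (N n) a' /\ bounded_clique a' (nth [::] (N n) a').
(* A least [a] exists because [good] is vacuous at e_c. *)
have /choice[m0 m0P] : forall p : I * nat, exists a, good p.1 p.2 a /\
    forall a', good p.1 p.2 a' -> a <= a'.
  move=> [c n]; apply: nat_least; exists (e c n) => a /andP[/leq_ltn_trans le].
  by move=> /le; rewrite ltnn.
pose m c n := m0 (c, n).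
have mgood c n : good c n (m c n) by have [] := m0P (c, n).
have me c i : succD c -> ae B' [set n | m c n <= e i n].
  move=> cS; apply: aeS (NP i c cS) => n gd.
  by have [_] := m0P (c, n); apply.
(* As the cut is unfilled, [m c] falls below some [d j] on an infinite subset of any given one;
   [distributive] makes this choice for all [c] on one set. *)
pose E c (X : set nat) := succD c ->
  exists2 j, D j & ae X [set n | m c n < d j n].
have [|||P [Pu PB' EP]] := @distributive E B'.
- exact: B'u.
- move=> c X X' EX X'u X'X cS; have [j Dj Xj] := EX cS.
  by exists j => //; exact: ae_trans Xj.
- move=> c X Xu XB'; have [cS|ncS] := pselect (succD c).
  2: by exists X; split => // /ncS.
  have [j [Dj nj]] : exists j, D j /\ ~ ae X [set n | d j n <= m c n].
    apply: contrapT => nex; apply: (@nofill X (m c)) => //.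
    + exact: subset_trans B'A.
    + by move=> j Dj; apply: contrapT => nj; apply: nex; exists j.
    + by move=> i; exact: ae_trans (sub_ae XB') (me c i cS).
  exists (X `&` [set n | m c n < d j n]); split.
  + move=> K; apply: contrapT => nex; apply: nj; exists K => n Kn Xn /=.
    by rewrite leqNgt; apply/negP => mj; apply: nex; exists n.
  + by move=> n [].
  + by move=> _; exists j => //; exists 0 => n _ [].
have /choice[eps epsP] : forall c, exists j, succD c ->
    D j /\ ae P [set n | m c n < d j n].
  move=> c; have [cS|ncS] := pselect (succD c); last by exists i0 => /ncS.
  by have [j Dj Pj] := EP c cS; exists j.
(* Otherwise d_(eps c) <= d_(g c b) almost everywhere. Let a be the maximum of m_b and m_c, so that
   a < d_(eps c). Then a is below e_b and e_c, N_a contains both codes, and their colour d_(g c b)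
   is at most a, a contradiction. *)
have geps b c : succD c -> lt b c -> eps b = eps c -> lt (g c b) (eps c).
  move=> cS bc ebc; apply: contrapT => nlt.
  have bS := succD_below cS bc.
  have [Dc mc] := epsP c cS; have [_ mb] := epsP b bS; rewrite ebc in mb.
  have toP Q : ae A Q -> ae P Q.
    by apply: ae_trans; apply: sub_ae; exact: subset_trans B'A.
  have dle : ae P [set n | d (eps c) n <= d (g c b) n].
    have [//|->|lt'] := lttot (g c b) (eps c); first by apply: sub_ae => n _ /=.
    by apply: toP; apply: dmono => //; exact: gD.
  have yP' := ae_trans (sub_ae (subset_trans PB' B'B)) (yP b c cS bc).
  have [n _ [_ [mbn [mcn [dn [[ybc Fbc] [eb ec]]]]]]] := unbounded_ae Pu
    (aeI mb (aeI mc (aeI dle (aeI yP' (aeI (toP _ (de b Dc)) (toP _ (de c Dc))))))) 0.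
  have [yb cl] : y b n \in nth [::] (N n) (maxn (m b n) (m c n)) /\
      bounded_clique (maxn (m b n) (m c n)) (nth [::] (N n) (maxn (m b n) (m c n))).
    by apply: (mgood b); rewrite leq_maxl gtn_max !(leq_trans _ eb).
  have [yc _] : y c n \in nth [::] (N n) (maxn (m b n) (m c n)) /\
      bounded_clique (maxn (m b n) (m c n)) (nth [::] (N n) (maxn (m b n) (m c n))).
    by apply: (mgood c); rewrite leq_maxr gtn_max !(leq_trans _ ec).
  have := cl _ _ yb yc ybc; rewrite Fbc => /(leq_trans dn).
  by rewrite leqNgt gtn_max mbn mcn.
(* h is injective on each fibre of eps, so succD embeds into D * D. *)
pose S c (h : I -> I) q := succD c ->
  D q /\ forall b, lt b c -> eps b = eps c -> h b <> q.
have [|c h h' q hh' H cS|c h Sh|h hP] :=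
  @wf_recursion _ _ i0 lt S (strict_wo_wf lt_wo).
- exact: ltt.
- have [Dq H'] := H cS; split => // b bc; rewrite -hh'//; exact: H'.
- have [cS|ncS] := pselect (succD c); last by exists i0 => /ncS.
  apply: contrapT => nex; have [Dc _] := epsP c cS.
  (* If [h] had used up all of [D] on the earlier part [W] of the fibre, then [D] would embed
     through [g c] below [eps c]. *)
  apply: (Dmin Dc); pose W := [set b | lt b c /\ eps b = eps c].
  apply: (@card_le_trans _ _ _ (h @` W)).
    apply: subset_card_le => x Dx; apply: contrapT => nx; apply: nex.
    by exists x => _; split => // b bc ebc hx; apply: nx; exists b.
  apply: (card_le_trans (card_image_le _ _)).
  apply: (@card_le_set_inj _ _ _ _ (g c)).
    by move=> b [bc ebc]; exact: geps.
  by move=> b b' [bc _] [b'c _]; have [_] := gP c cS; apply.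
apply: succD_not_le; apply: card_le_trans (card_square Dinf).
apply: (@card_le_set_inj _ _ _ _ (fun c => (eps c, h c))).
  by move=> c cS; split; [have [] := epsP c cS|have [] := hP c cS].
move=> b c bS cS [ebc hbc].
have [bc|//|cb] := lttot b c.
  by have [_ /(_ b bc ebc)] := hP c cS.
by have [_ /(_ c cb (esym ebc))] := hP b bS; rewrite hbc.
Qed.

End cut.

Lemma directed_pseudointersection (B : I -> set nat) :
  (forall b, unbounded (B b)) ->
  (forall b c, exists a, B a `<=` B b `&` B c) ->
  exists2 P, unbounded P & forall b, ae P (B b).
Proof.
move=> Bu Bdir; have [lti ltt lttot ltmin] := lt_wo.
apply: contrapT => noP.
pose bad m := exists D C, [/\ D `<=` below lt m,
  forall i j, D i -> D j -> lt j i -> ae (C i) (C j),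
  forall j b, D j -> unbounded (C j `&` B b) &
  ~ (exists A, (forall j, D j -> ae A (C j)) /\
               forall b, unbounded (A `&` B b))].
have [m0 bad0] : bad !=set0.
  apply: contrapT => nbad; apply: noP.
  pose S i (h : I -> set nat) q := [/\ forall b, unbounded (q `&` B b),
    ae q (B i) & forall j, lt j i -> ae q (h j)].
  have [|i h h' q hh' [? ? H]|i h Sh|h hP] :=
    @wf_recursion _ _ set0 lt S (strict_wo_wf lt_wo).
  - exact: ltt.
  - by split => // j ji; rewrite -hh'//; exact: H.
  - have [[A [AD Au]]|nA] := pselect (exists A, (forall j, lt j i -> ae A (h j)) /\
        forall b, unbounded (A `&` B b)).
      exists (A `&` B i); split.
      + move=> b; have [a aP] := Bdir i b; apply: unboundedS (Au a) => n [An Ban].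
        by have [] := aP n Ban.
      + by apply: sub_ae => n [].
      + by move=> j ji; apply: ae_trans (AD j ji); apply: sub_ae => n [].
    exfalso; apply: nbad; exists i, (below lt i), h; split => //.
    + by move=> j k /Sh[_ _ H] _; exact: H.
    + by move=> j b /Sh[].
  have setTu : unbounded setT by move=> N; exists N.
  have hu i : unbounded (h i).
    by have [Hi _ _] := hP i; apply: unboundedS (Hi i) => n [].
  have [||||P [Pu _ PH]] := @tower_pseudointersection _ lt setT setT h lt_wo I_tower.
  - exact: setTu.
  - by move=> i _; exact: hu.
  - by move=> i _; exact: sub_ae.
  - by move=> i j _ _; have [_ _] := hP i; apply.
  exists P => // b; have [_ hb _] := hP b.
  by apply: ae_trans hb; exact: PH.
(* By minimality of m, D does not embed below any of its elements. *)
have [m [D [C [Dm Cdec CB nofill]]] mmin] := ltmin bad (ex_intro _ m0 bad0).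
have Dsmall : ~ ([set: I] #<= D).
  move=> /card_le_trans IDm; apply: (@below_small m); apply: IDm.
  exact: subset_card_le.
have Dinf : infinite_set D.
  move=> /finite_seqP[s Ds]; apply: nofill; have [s0|s0] := eqVneq s [::].
    by exists setT; split=> [j|b]; rewrite ?Ds ?s0 ?setTI.
  have [b bs bmax] := seq_max s0.
  have sD j : j \in s -> D j by rewrite Ds.
  exists (C b); split=> [j|b']; last by apply: CB; exact: sD.
  rewrite Ds /= => js; have [jb|->] := bmax j js; last exact: ae_refl.
  by apply: Cdec => //; exact: sD.
have Dmin i : D i -> ~ (D #<= below lt i).
  move=> Di /(card_le_fun i0)[phi phii phiinj]; apply: (mmin i); last exact: Dm.
  (* The injection [phi] need not preserve the order, but it increases on [R]. Moreover [R] is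
     cofinal in [D]: from any [j] on, take the index with the least image. The chain restricted to
     [R] and reindexed below [i] would make [i] bad. *)
  pose R := [set j | D j /\ forall k, D k -> lt j k -> lt (phi j) (phi k)].
  have /choice[psi psiP] : forall x, exists j, (phi @` R) x -> R j /\ phi j = x.
    move=> x; have [[j Rj jx]|nx] := pselect ((phi @` R) x); first by exists j.
    by exists i0 => /nx.
  exists (phi @` R), (C \o psi); split.
  - by move=> _ [j [Dj _] <-]; exact: phii.
  - move=> x x' /psiP[[Dx Rx] xE] /psiP[[Dx' Rx'] xE'] x'x /=.
    apply: Cdec => //; have [//|e|lt'] := lttot (psi x') (psi x).
      by move: x'x; rewrite -xE -xE' e => /lti.
    by case: (lti x); apply: ltt x'x; rewrite -xE -xE'; exact: Rx.
  - by move=> x b /psiP[[Dx _] _]; exact: CB.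
  - move=> [A [AC AB]]; apply: nofill; exists A; split => // j Dj.
    have [|_ [k [Dk jk] <-] kmin] :=
        ltmin (phi @` [set k | D k /\ (lt j k \/ j = k)]).
      by exists (phi j), j => //; split => //; right.
    have Rk : R k.
      split => // l Dl kl; have [//|e|lk] := lttot (phi k) (phi l).
        by case: (lti k); rewrite {2}(phiinj _ _ Dk Dl e).
      case: (kmin (phi l)) => //; exists l => //; split => //; left.
      by case: jk => [jk|->//]; exact: ltt kl.
    have [[Dpsi _] psik] : R (psi (phi k)) /\ phi (psi (phi k)) = phi k.
      by apply: psiP; exists k.
    have := AC (phi k); rewrite /= (phiinj _ _ Dpsi Dk psik) => ACk.
    apply: (ae_trans (ACk _)); first by exists k.
    by case: jk => [jk|<-]; [exact: Cdec|exact: ae_refl].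
have [A [d [e [Au dmono emono de nof]]]] := chain_cut Dm Bu Cdec CB nofill.
exact: (@no_cut D A d e).
Qed.

End below_tower_number.

(** * The equality p = t *)

Definition finite_meets (F : set (set nat)) : Prop :=
  forall s : seq (set nat), (forall A, A \in s -> F A) ->
    unbounded [set n | forall A, A \in s -> A n].

Lemma countable_pseudointersection (F : set (set nat)) : countable F ->
  finite_meets F -> exists2 P, unbounded P & forall A, F A -> ae P A.
Proof.
move=> Fc Ff; have [F0|/set0P Fn] := eqVneq F set0.
  by exists setT; [move=> N; exists N|move=> A; rewrite F0].
have [f [fF fsurj]] := card_cover Fn Fc.
have /choice[x xP] : forall k, exists n, k <= n /\ forall i, i <= k -> f i n.
  move=> k; have [|n kn nP] := Ff [seq f i | i <- iota 0 k.+1] _ k.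
    by move=> A /mapP[i _ ->].
  exists n; split => // i ik; apply: nP; apply/mapP; exists i => //.
  by rewrite mem_iota.
exists (range x).
  by move=> N; exists (x N); [have [] := xP N|exists N].
move=> A /fsurj[i _ <-]; have [K KP] := bounded_image x i.
exists K => n Kk [k _ kn]; rewrite -kn in Kk *; have [_] := xP k; apply.
by rewrite leqNgt; apply/negP => /KP; rewrite ltnNge Kk.
Qed.

(** A counterexample [F0] of least cardinality serves as its own index type: minimality is
    saturation, and by [countable_pseudointersection] it is uncountable. *)
Lemma finite_meets_pseudointersection (F : set (set nat)) :
  ~ (tower_number #<= F) -> finite_meets F ->
  exists2 P, unbounded P & forall A, F A -> ae P A.
Proof.
move=> tF Ff; apply: contrapT => nP.
pose bad := [set F | finite_meets F /\
  ~ exists2 P, unbounded P & forall A, F A -> ae P A].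
have [|F0 [[F0f F0P] F0min]] := @exists_least_card _ bad; first by exists F.
have tF0 : ~ (tower_number #<= F0).
  by move=> /card_le_trans tF0; apply: tF; apply: tF0; exact: F0min.
pose I : choiceType := set_type F0.
have IF0 : [set: I] #<= F0.
  apply: (@card_le_set_inj _ _ _ _ val) => [x _|x y _ _].
    exact: set_valP.
  exact: val_inj.
have F0I : F0 #<= [set: I].
  have [->|/set0P[A0 FA0]] := eqVneq F0 set0; first exact: card_ge0.
  apply: (@card_le_set_inj _ _ _ _ (fun A => if pselect (F0 A) is left p
    then SigSub (mem_set p) else SigSub (mem_set FA0) : I)) => // A A' FA FA'.
  by case: pselect => // p; case: pselect => // p' /(congr1 val).
have Iunc : ~ countable [set: I].
  move=> Ic; apply: F0P; apply: countable_pseudointersection => //.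
  exact: sub_countable F0I Ic.
have Iinf : infinite_set [set: I] by move=> /finite_set_countable.
have [i0 _] := infinite_setN0 Iinf.
have [lt lt_wo lt_small] := initial_wo I.
have sat F' : ~ ([set: I] #<= F') -> finite_meets F' ->
    exists2 P, unbounded P & forall A, F' A -> ae P A.
  move=> IF' F'f; apply: contrapT => nP'; apply: IF'.
  by apply: (card_le_trans IF0); exact: F0min.
(* Enumerating the finite sequences by [I] turns [F0] into a directed family, that of its finite
   meets, with the same index type. *)
have [f [_ fsurj]] : exists f : I -> seq I, (forall y, [set: seq I] (f y)) /\
    forall s, [set: seq I] s -> exists2 y, [set: I] y & f y = s.
  by apply: card_cover; [exists [::]|exact: card_seq].
have [|||P Pu PB] := @directed_pseudointersection I i0 lt lt_wo _ sat Iunc Iinf lt_small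
    (fun i => [set n | forall A, A \in f i -> val A n]).
- by move=> tI; apply: tF0; exact: card_le_trans IF0.
- move=> i; apply: (@unboundedS _ _ _ (F0f [seq val A | A <- f i] _)).
    by move=> n nP' A Af; apply: nP'; exact: map_f.
  by move=> _ /mapP[A _ ->]; exact: set_valP.
- move=> b c; have [a _ aE] := fsurj (f b ++ f c) Logic.I.
  exists a => n; rewrite /= aE => nP'; split=> A Af; apply: nP';
    by rewrite mem_cat Af ?orbT.
apply: F0P; exists P => // A FA.
have [a _ aE] := fsurj [:: SigSub (mem_set FA) : I] Logic.I.
by apply: aeS (PB a) => n; rewrite /= aE => /(_ _ (mem_head _ _)).
Qed.

(** * Compactifications *)

(** For each point of [V] other than [z], some neighbourhood of [z] has a closure omitting it. A
    sequence eventually in all these neighbourhoods clusters only at [z], hence converges by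
    compactness. *)
Lemma countable_nbhs_sequence (Y : topologicalType) (z : Y) (A V : set Y) :
  compact [set: Y] -> hausdorff_space Y -> nbhs z V -> countable V ->
  closure A z -> exists u : nat -> Y, (forall n, A (u n)) /\ u @ \oo --> z.
Proof.
move=> Yc Yh zV Vc Az.
have [|W0 zW0 W0V] := compact_regular Yh Yc _ zV; first exact: filterT.
have Vn : V !=set0 by exists z; exact: nbhs_singleton.
have [v [_ vsurj]] := card_cover Vn Vc.
have /choice[W WP] : forall k, exists W, nbhs z W /\ (v k <> z -> ~ closure W (v k)).
  move=> k; have [->|/eqP vz] := eqVneq (v k) z.
    by exists setT; split => //; exact: filterT.
  move: Yh; rewrite open_hausdorff => /(_ (v k) z)[|[O1 O2] /= [vO1 zO2] [O1o O2o O120]].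
    exact/eqP.
  exists O2; split; first by apply: open_nbhs_nbhs; split => //; rewrite inE in zO2.
  move=> _ /(_ O1)[|y [O2y O1y]].
    by apply: open_nbhs_nbhs; split => //; rewrite inE in vO1.
  by have /seteqP[/(_ y) + _] := eqP O120; apply.
pose U n := W0 `&` [set y | forall k, k <= n -> W k y].
have zU n : nbhs z (U n).
  apply: filterI => //; elim: n => [|n IH].
    by have [zW _] := WP 0; apply: filterS zW => y Wy k; rewrite leqn0 => /eqP->.
  have [zW _] := WP n.+1; apply: filterS2 zW IH => y Wy Uy k.
  by rewrite leq_eqVlt => /orP[/eqP->//|]; exact: Uy.
have /choice[u uP] : forall n, exists y, A y /\ U n y.
  by move=> n; have [y [Ay Uy]] := Az _ (zU n); exists y.
exists u; split; first by move=> n; have [] := uP n.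
have uW n : \forall m \near \oo, W n (u m).
  by exists n => // m /= nm; have [_ [_]] := uP m; apply.
have uW0 : \forall m \near \oo, W0 (u m).
  by exists 0 => // m _; have [_ []] := uP m.
have uz y : cluster (u @ \oo) y -> y = z.
  rewrite clusterE => uy; have /vsurj[k _ vk] : V y by apply/W0V/uy.
  apply: contrapT => yz; have [_ ncl] := WP k.
  by apply: ncl; rewrite vk//; exact/uy/uW.
apply: (compact_cluster_set1 Yh Yc) => //; try exact: filterT.
apply/seteqP; split=> [y /uz//|_ ->].
by have [y [_ uy]] := Yc _ _ (filterT : (u @ \oo) setT); rewrite -(uz y uy).
Qed.

Lemma embedding_continuous (X Y : topologicalType) (e : X -> Y) :
  embedding e -> continuous e.
Proof.
by move=> [_ eo]; apply/continuousP => B Bo; apply/eo; exists B.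
Qed.

(** The image of a compact neighbourhood [K] is closed. By density it contains every open set of [Y]
    whose trace on [X] lies in [K]. *)
Lemma open_range_compactification (X Y : topologicalType) (e : X -> Y) :
  locally_compact [set: X] -> compactification e -> open (range e).
Proof.
move=> Xlc [Yc Yh eemb ed]; have [_ eo] := eemb.
rewrite openE => _ [x _ <-].
have [K] := Xlc x Logic.I; rewrite withinET => xK [Kc _].
have eKcl : closed (e @` K).
  apply: compact_closed => //; apply: continuous_compact => //.
  exact/continuous_subspaceT/embedding_continuous.
move: xK; rewrite nbhsE => -[O [/eo[V Vo VO] Ox] OK].
apply: (@filterS _ _ _ V); last first.
  by apply: open_nbhs_nbhs; split => //; rewrite -VO in Ox.
move=> y Vy; suff [k _ <-] : (e @` K) y by exists k.
apply: eKcl => B yB.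
have [|t [[Vt Bt] [x' _ x't]]] := ed (V `&` B°) _ (openI Vo (open_interior _)).
  by exists y.
exists t; split; last exact: interior_subset.
by exists x' => //; apply: OK; rewrite -VO /= x't.
Qed.

(** After coding [C] by numbers, the traces of a least neighbourhood base form fewer than t sets
    with infinite finite meets: they are infinite because points are closed and [z] is not in [C]. A
    pseudointersection yields the sequence. *)
Lemma character_sequence (Y : topologicalType) (z : Y) (C : set Y) :
  accessible_space Y -> countable C -> ~ C z -> closure C z ->
  ~ (tower_number #<= character z) ->
  exists u : nat -> Y, (forall n, C (u n)) /\ u @ \oo --> z.
Proof.
move=> T1 Cc nCz Cz tz.
have [[Bnbhs Bbase] _] := characterP z.
have [y0 Cy0] : C !=set0 by have [y [Cy _]] := Cz _ filterT; exists y.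
have [code _ codeinj] := card_le_fun 0 Cc.
pose tr U := code @` (C `&` U).
have Cinf U : nbhs z U -> infinite_set (C `&` U).
  move=> zU CUfin; have := (accessible_finite_set_closed.1 T1) _ CUfin.
  move=> /(_ z) H; apply: nCz; suff [] : (C `&` U) z by [].
  apply: H => B zB; have [y [Cy [Uy By]]] := Cz _ (filterI zU zB).
  by exists y.
have trU U : nbhs z U -> unbounded (tr U).
  move=> /Cinf CU; apply/infinite_unbounded => /(card_le_finite _) trfin.
  apply: CU; apply: trfin; apply: (@card_le_set_inj _ _ _ _ code).
    by move=> y CUy; exists y.
  move=> y y' [Cy _] [Cy' _].
  exact: codeinj.
have [||P Pu PF] := @finite_meets_pseudointersection (tr @` character z).
- by move=> tF; apply: tz; exact: card_le_trans tF (card_image_le _ _).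
- move=> s sF.
  have [U zU Us] : exists2 U, nbhs z U & forall A, A \in s -> tr U `<=` A.
    elim: s sF => [_|A s IH sF]; first by exists setT; [exact: filterT|].
    have [B' /Bnbhs zB <-] := sF A (mem_head _ _).
    have [|U zU Us] := IH; first by move=> A' A's; apply: sF; rewrite inE A's orbT.
    exists (B' `&` U); first exact: filterI.
    move=> A'; rewrite inE => /orP[/eqP->|/Us trU'] _ [y [Cy [By Uy]] <-].
      by exists y.
    by apply: trU'; exists y.
  by apply: unboundedS (trU U zU) => n Un A /Us; apply.
have PU U : nbhs z U -> ae P (tr U).
  move=> /Bbase[B' zB B'U]; have := PF (tr B') (ex_intro2 _ _ B' zB erefl).
  by apply: aeS => _ [y [Cy By] <-]; exists y => //; split => //; exact: B'U.
(* The bound [n <= m] makes the chosen codes tend to infinity, so they eventually enter the trace of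
   each neighbourhood. *)
have /choice[p pP] : forall n, exists m, [/\ n <= m, P m & tr setT m].
  move=> n; have [N PN] := PU _ filterT; have [m] := Pu (maxn n N).
  by rewrite geq_max => /andP[nm Nm] Pm; exists m; split => //; exact: PN.
have /choice[u uP] : forall n, exists y, C y /\ code y = p n.
  by move=> n; have [_ _ [y [Cy _] yp]] := pP n; exists y.
exists u; split; first by move=> n; have [] := uP n.
move=> U zU; have [N PN] := PU U zU.
exists N => // n /= Nn; have [np Pp _] := pP n.
have [y [Cy Uy] yp] := PN _ (leq_trans Nn np) Pp.
have [Cu up] := uP n.
by rewrite (codeinj (u n) y)// up.
Qed.

Theorem theorem3p14 (X gX : topologicalType) (e : X -> gX) :
  countable [set: X] -> locally_compact [set: X] -> ~ compact [set: X] ->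
  hausdorff_space X ->
  compactification e ->
  frechet_urysohn (set_type (~` range e)) ->
  (forall z : gX, (~` range e) z -> character z #< tower_number) ->
  frechet_urysohn gX.
Proof.
move=> Xc Xlc _ _ ecomp remFU chi z A Az.
have [gXc gXh _ _] := ecomp.
have rc : countable (range e) by exact: sub_countable (card_image_le _ _) Xc.
have [zr|nzr] := pselect (range e z).
  apply: (countable_nbhs_sequence gXc gXh _ rc Az).
  by apply: open_nbhs_nbhs; split => //; exact: open_range_compactification.
have sub (B : set gX) : B `<=` A ->
    (exists u : nat -> gX, (forall n, B (u n)) /\ u @ \oo --> z) ->
    exists u : nat -> gX, (forall n, A (u n)) /\ u @ \oo --> z.
  by move=> BA [u [uB uz]]; exists u; split => // n; exact: BA.
have : closure (A `&` range e) z \/ closure (A `\` range e) z.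
  have : closure ((A `&` range e) `|` (A `\` range e)) z.
    by rewrite setUIDK.
  by rewrite closureU.
case=> {}Az.
  apply: (sub (A `&` range e)); first by move=> y [].
  apply: character_sequence => //.
  - exact: hausdorff_accessible.
  - by apply: sub_countable rc; apply: subset_card_le => y [].
  - by move=> [].
  - by have [_] := chi z nzr.
apply: (sub (A `\` range e)); first by move=> y [].
pose R := set_type (~` range e).
pose toR y (nry : (~` range e) y) : R := SigSub (mem_set nry).
pose z' := toR z nzr.
have [|u [uA uz]] := remFU z' (set_val @^-1` A).
  move=> S [O [[B Bo BO] Oz' OS]]; rewrite -BO in Oz' OS.
  have [|y [[Ay nry] By]] := Az B; first exact: open_nbhs_nbhs.
  by exists (toR y nry); split => //; exact: OS.
exists (fun n => set_val (u n)); split.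
  by move=> n; split; [exact: uA|exact: (set_valP (u n))].
apply: (cvg_comp _ _ uz).
exact: (@initial_continuous _ _ (set_val : R -> gX) z').
Qed.
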